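(* Let $G=\mathrm{PSL}_2(\mathbb{F}_8)$ and $H\simeq(C_2)^3\rtimes C_7$ the normalizer of a Sylow $2$-subgroup. There is a flabby resolution $0\to J_{G/H}\to P\to F\to0$ with $\mathrm{rank}_{\mathbb{Z}}F=64$ such that there is an isomorphism of $G$-lattices $$\mathbb{Z}[G/C_3]\oplus\mathbb{Z}[G/C_9]\oplus\mathbb{Z}[G/D_7]\simeq\mathbb{Z}[G/C_3]\oplus\mathbb{Z}[G/D_9]\oplus F$$ (rank $260$). In particular $F$ is stably permutation.
   Context: A $G$-lattice is a finitely generated $\mathbb{Z}[G]$-module free over $\mathbb{Z}$. A permutation $G$-lattice is one isomorphic to $\bigoplus_i\mathbb{Z}[G/H_i]$. Stably permutation: $M\oplus P\simeq P'$ with $P,P'$ permutation. $F$ is flabby if $\widehat H^{-1}(H',F)=0$ for all subgroups $H'\le G$. A flabby resolution of $M$ is an exact sequence $0\to M\to P\to F\to0$ with $P$ permutation and $F$ flabby. The Chevalley module is $J_{G/H}=\mathrm{Hom}_{\mathbb{Z}}(I_{G/H},\mathbb{Z})$ where $I_{G/H}=\ker(\mathbb{Z}[G/H]\to\mathbb{Z})$. $D_n$ is dihedral of order $2n$; in $\mathrm{PSL}_2(\mathbb{F}_8)$ the subgroups isomorphic to $C_3$, $C_9$, $D_7$, $D_9$ are each unique up to conjugacy. *)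

(* Defs.v *)
From HB Require Import structures.
From mathcomp Require Import all_boot all_order all_algebra all_fingroup all_solvable all_field.
Unset Printing Implicit Defensive.
Import GRing.Theory.
Local Open Scope ring_scope.

Section PSL.
Variable F : finFieldType.

Definition SL2_set : {set {'GL_2[F]}} :=
  [set x : {'GL_2[F]} | \det (GLval x) == 1].
Definition SL2 : {group {'GL_2[F]}} := <<SL2_set>>%G.

Definition scalarsGL_set : {set {'GL_2[F]}} :=
  [set x : {'GL_2[F]} | is_scalar_mx (GLval x)].
Definition scalarsGL : {group {'GL_2[F]}} := <<scalarsGL_set>>%G.

(* PSL_2(F) = SL_2(F) Z / Z  ~=  SL_2(F) / (SL_2(F) \cap Z) *)
Definition PSL2 : {group coset_of scalarsGL} := (SL2 / scalarsGL)%G.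
End PSL.

(* G-lattices: Z^n with a left action of G given by integer matrices   *)
(* acting on column vectors.                                           *)
Section Lattices.
Variable gT : finGroupType.
Implicit Types G H : {group gT}.

Record glat := GLat { rk : nat; rep : gT -> 'M[int]_rk }.

Definition is_glat G (L : glat) :=
  rep L 1 = 1%:M /\
  forall g h, g \in G -> h \in G -> rep L (g * h)%g = rep L g *m rep L h.

Definition equivariant G (L1 L2 : glat) (A : 'M[int]_(rk L2, rk L1)) :=
  forall g, g \in G -> rep L2 g *m A = A *m rep L1 g.

Definition lat_iso G (L1 L2 : glat) :=
  exists (A : 'M[int]_(rk L2, rk L1)) (B : 'M[int]_(rk L1, rk L2)),
    [/\ A *m B = 1%:M, B *m A = 1%:M & equivariant G L1 L2 A].

Definition dsum (L1 L2 : glat) : glat :=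
  @GLat (rk L1 + rk L2) (fun g => block_mx (rep L1 g) 0 0 (rep L2 g)).

Definition zero_lat : glat := @GLat 0 (fun _ => 1%:M).

(* permutation lattice Z[G/H], basis = left cosets xH, g.e_{xH} = e_{gxH} *)
Definition perm_lat G H : glat :=
  @GLat #|lcosets H G|
    (fun g => \matrix_(i, j)
        ((enum_val i == lcoset (enum_val j) g)%:R : int)).

Definition permutation_lat G (L : glat) :=
  is_glat G L /\
  exists Hs : seq {group gT}, all (fun H => H \subset G) Hs /\
    lat_iso G L (foldr dsum zero_lat [seq perm_lat G H | H <- Hs]).

Definition stably_permutation G (L : glat) :=
  is_glat G L /\
  exists P P' : glat, [/\ permutation_lat G P, permutation_lat G P' &
                         lat_iso G (dsum L P) P'].

(* Tate cohomology \hat H^{-1}(H', L) = ker N_{H'} / I_{H'} L vanishes *)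
Definition tateHm1_trivial (H' : {group gT}) (L : glat) :=
  forall x : 'cV[int]_(rk L),
    \sum_(h in H') (rep L h *m x) = 0 ->
    exists y : gT -> 'cV[int]_(rk L),
      x = \sum_(h in H') ((rep L h - 1%:M) *m y h).

Definition flabby G (L : glat) :=
  is_glat G L /\
  forall H' : {group gT}, H' \subset G -> tateHm1_trivial H' L.

Definition flabby_resolution G (M P F : glat)
    (A : 'M[int]_(rk P, rk M)) (B : 'M[int]_(rk F, rk P)) :=
  is_glat G M /\ permutation_lat G P /\ flabby G F /\
  equivariant G M P A /\ equivariant G P F B /\
  (forall x : 'cV[int]_(rk M), A *m x = 0 -> x = 0) /\
  (forall z : 'cV[int]_(rk F), exists y : 'cV[int]_(rk P), B *m y = z) /\
  (forall y : 'cV[int]_(rk P),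
     B *m y = 0 <-> exists x : 'cV[int]_(rk M), y = A *m x).

(* Z-dual Hom_Z(L, Z), with (g f)(x) = f(g^-1 x) *)
Definition dual_lat (L : glat) : glat :=
  @GLat (rk L) (fun g => (rep L g^-1)^T).

Definition is_augmentation_lat G H (L : glat) :=
  is_glat G L /\
  exists A : 'M[int]_(rk (perm_lat G H), rk L),
    [/\ equivariant G L (perm_lat G H) A,
        (forall x : 'cV[int]_(rk L), A *m x = 0 -> x = 0) &
        (forall y : 'cV[int]_(rk (perm_lat G H)),
           (exists x : 'cV[int]_(rk L), y = A *m x) <-> \sum_i y i 0 = 0)].

Definition is_chevalley_lat G H (L : glat) :=
  exists I, is_augmentation_lat G H I /\ L = dual_lat I.

End Lattices.
Arguments GLat {gT}. Arguments rk {gT}. Arguments rep {gT}.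
Arguments is_glat {gT}. Arguments equivariant {gT}. Arguments lat_iso {gT}.
Arguments dsum {gT}. Arguments zero_lat {gT}. Arguments perm_lat {gT}.
Arguments permutation_lat {gT}. Arguments stably_permutation {gT}.
Arguments tateHm1_trivial {gT}. Arguments flabby {gT}.
Arguments flabby_resolution {gT}. Arguments dual_lat {gT}.
Arguments is_augmentation_lat {gT}. Arguments is_chevalley_lat {gT}.

(* Main.v *)
(** Let [X] be the projective line over the field with 8 elements.  The
    permutation lattice on ordered pairs of distinct points of [X] is
    [Z[G/C7]], and [(x, y) |-> x - y] maps it onto the augmentation lattice
    of [X]; dualizing gives an embedding of [J] in [Z[G/C7]], split over [Z],
    whose cokernel [F] has rank [72 - 8].  An equivariant map from
    [Z[G/C3] + Z[G/D9] + F] to [Z[G/C3] + Z[G/C9] + Z[G/D7]] amounts to vectors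
    fixed by [C3], by [D9] and by [C7], the last of which must be annihilated
    by [J].  For the three vectors below, a computer search found preimages of
    the base vectors of the three summands of the target; by equivariance the
    map is then onto, and as both ranks are 260 it is an isomorphism.  Hence
    [F] is stably permutation, and it is flabby as a direct summand of a
    permutation lattice.  The subgroups in the statement are determined up to
    conjugacy by Sylow's theorem: [C9] is a Sylow 3-subgroup, and [D7], [D9]
    are normalizers of Sylow subgroups. *)

From Stdlib Require Import ZArith.
Require Import Defs.
From HB Require Import structures.
From mathcomp Require Import all_boot all_order all_algebra all_fingroup all_solvable all_field.
From mathcomp Require Import ring ssrZ.
Set Implicit Arguments. Unset Strict Implicit. Unset Printing Implicit Defensive.
Import GRing.Theory Num.Theory.
Local Open Scope ring_scope.

(** The field is arbitrary and the group consists of cosets of scalar matrices, while the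
    certificate consists of explicit numbers. All finite checks therefore run on matrices over
    boolean triples, and an injective multiplicative map onto the group carries their results over.
    The subgroups of the statement are arbitrary too: each permutation lattice is first replaced by
    one whose basis is an explicit list of cosets, and conjugacy gives the isomorphism with the
    lattice of the statement. For the nine points this isomorphism must also respect the sum of
    coordinates, because the augmentation lattice is its kernel. The cokernel needs an explicit
    integral basis. It comes from one distinguished point: the eight pairs ending there have
    differences that form a basis of the augmentation lattice, so the other 64 pairs are a basis of
    the cokernel. The representatives of the cosets are visited along a walk, so that all translates
    of a vector are obtained by repeatedly permuting coordinates. *)

(** * A computable model of SL(2, 8) *)

(* [(x0, x1, x2)] stands for [x0 + x1 a + x2 a ^ 2], where [a ^ 3 = a + 1]. *)
Definition f8 := (bool * bool * bool)%type.
Definition sl2 := (f8 * f8 * f8 * f8)%type.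

Definition f8_0 : f8 := (false, false, false).
Definition f8_1 : f8 := (true, false, false).
Definition f8_add (x y : f8) : f8 :=
  let: (x0, x1, x2) := x in let: (y0, y1, y2) := y in
  (x0 (+) y0, x1 (+) y1, x2 (+) y2).
(** [d3] and [d4] are the coefficients of a^3 = a + 1 and a^4 = a^2 + a in the unreduced product. *)
Definition f8_mul (x y : f8) : f8 :=
  let: (x0, x1, x2) := x in let: (y0, y1, y2) := y in
  let d3 := x1 && y2 (+) x2 && y1 in let d4 := x2 && y2 in
  (x0 && y0 (+) d3,
   x0 && y1 (+) x1 && y0 (+) d3 (+) d4,
   x0 && y2 (+) x1 && y1 (+) x2 && y0 (+) d4).

Definition sl2_one : sl2 := (f8_1, f8_0, f8_0, f8_1).
Definition sl2_mul (m n : sl2) : sl2 :=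
  let: (a, b, c, d) := m in let: (a', b', c', d') := n in
  (f8_add (f8_mul a a') (f8_mul b c'), f8_add (f8_mul a b') (f8_mul b d'),
   f8_add (f8_mul c a') (f8_mul d c'), f8_add (f8_mul c b') (f8_mul d d')).
(* The inverse of a matrix of determinant 1 in characteristic 2. *)
Definition sl2_inv (m : sl2) : sl2 := let: (a, b, c, d) := m in (d, b, c, a).
Definition sl2_det (m : sl2) : f8 :=
  let: (a, b, c, d) := m in f8_add (f8_mul a d) (f8_mul b c).

Definition f8_elts : seq f8 :=
  [seq (xy, z) | z <- [:: false; true],
                 xy <- [seq (x, y) | y <- [:: false; true], x <- [:: false; true]]].
Definition sl2_elts : seq sl2 :=
  [seq m <- allpairs pair (allpairs pair (allpairs pair f8_elts f8_elts) f8_elts)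
              f8_elts | sl2_det m == f8_1].

Lemma f8_enum x : x \in f8_elts.
Proof. by case: x => [[[] []] []]. Qed.

Lemma sl2_enum m : (m \in sl2_elts) = (sl2_det m == f8_1).
Proof.
rewrite mem_filter; case: m => [[[a b] c] d].
by rewrite (allpairs_f pair) ?andbT //; do 2?apply: (allpairs_f pair) => //;
   exact: f8_enum.
Qed.

Lemma size_sl2_elts : size sl2_elts = 504%N.
Proof. by vm_compute. Qed.

Lemma uniq_sl2_elts : uniq sl2_elts.
Proof. by apply: filter_uniq; do !apply: allpairs_uniq => //; move=> [? ?] [? ?]. Qed.

(** * A root of X^3 - X - 1 in a field with 8 elements *)

Section Field.
Variable F : finFieldType.
Hypothesis cardF : #|F| = 8%N.

Lemma pchar2 : 2%N \in [pchar F].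
Proof. by apply: (@card_finPcharP _ 2 3). Qed.

Lemma add2 : 1 + 1 = 0 :> F.
Proof. exact: (addrr_pchar2 pchar2). Qed.

(** In characteristic 2, X^8 - X = X (X - 1) c(X) c(X + 1) with c(X) = X^3 - X - 1, so any x other
    than 0 and 1 satisfies c(x) = 0 or c(x + 1) = 0. *)
Lemma cubic_root_exists : exists a : F, a ^+ 3 = a + 1.
Proof.
have [x x0 x1] : exists2 x : F, x != 0 & x != 1.
  have /card_gt0P[x] : (0 < #|[set~ (0%R : F)] :\ 1%R|)%N.
    have := cardsC1 (0%R : F); rewrite cardF (cardsD1 1) !inE oner_neq0 add1n.
    by case=> ->.
  by rewrite !inE => /andP[x1 x0]; exists x.
have /eqP : (x - 1) * ((x ^+ 3 - (x + 1)) * ((x + 1) ^+ 3 - (x + 1 + 1))) = 0.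
  apply: (mulfI x0); rewrite mulr0.
  have x8 : x ^+ 8 - x = 0 by rewrite -{1}cardF expf_card subrr.
  (* The factorization holds modulo 2 only; the multiple of [1 + 1] is the exact difference over the
     integers, which makes the equality an identity for [ring]. *)
  transitivity (x ^+ 8 - x + (1 + 1) * (x ^+ 7 - x ^+ 6 - x ^+ 5 *+ 3 + x ^+ 3 *+ 2 + x ^+ 2));
    last by rewrite add2 x8 mul0r addr0.
  ring.
rewrite !mulf_eq0 subr_eq0 (negbTE x1) /= !subr_eq0.
by case/orP=> /eqP h; [exists x | exists (x + 1)].
Qed.
End Field.

(** * The isomorphism of the model with PSL(2, 8) *)

Section Embedding.
Variable F : finFieldType.
Hypothesis cardF : #|F| = 8%N.
Variable a : F.
Hypothesis a3 : a ^+ 3 = a + 1.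

Definition f8_val (x : f8) : F :=
  let: (x0, x1, x2) := x in x0%:R + x1%:R * a + x2%:R * a ^+ 2.

Lemma natr_addb (b c : bool) : (b (+) c)%:R = b%:R + c%:R :> F.
Proof. by case: b c => [] [] /=; rewrite ?addr0 ?add0r ?(add2 cardF). Qed.

Lemma f8_valD x y : f8_val (f8_add x y) = f8_val x + f8_val y.
Proof.
by case: x y => [[x0 x1] x2] [[y0 y1] y2] /=; rewrite !natr_addb; ring.
Qed.

Lemma natr_andb (b c : bool) : (b && c)%:R = b%:R * c%:R :> F.
Proof. by case: b c => [] [] /=; rewrite ?mulr0 ?mul0r ?mulr1. Qed.

Lemma f8_valM x y : f8_val (f8_mul x y) = f8_val x * f8_val y.
Proof.
case: x y => [[x0 x1] x2] [[y0 y1] y2] /=; rewrite !natr_addb !natr_andb.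
have a4 : a ^+ 4 = a ^+ 2 + a by rewrite exprS a3; ring.
transitivity (x0%:R * y0%:R + (x0%:R * y1%:R + x1%:R * y0%:R) * a
  + (x0%:R * y2%:R + x1%:R * y1%:R + x2%:R * y0%:R) * a ^+ 2
  + (x1%:R * y2%:R + x2%:R * y1%:R) * a ^+ 3 + x2%:R * y2%:R * a ^+ 4).
  by rewrite a3 a4; ring.
by ring.
Qed.

Lemma f8_val0 : f8_val f8_0 = 0. Proof. by rewrite /f8_val /=; ring. Qed.
Lemma f8_val1 : f8_val f8_1 = 1. Proof. by rewrite /f8_val /=; ring. Qed.

(** The model is a field: exhausting its eight elements yields an inverse of any nonzero [x], and a
    multiplicative map sending 1 to 1 cannot kill a unit. *)
Lemma f8_val_eq0 x : f8_val x = 0 -> x = f8_0.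
Proof.
move=> x0; have [-> //|nx0] := eqVneq x f8_0.
have [y xy] : exists y, f8_mul x y = f8_1.
  have /hasP[y _ /eqP xy] : has (fun y => f8_mul x y == f8_1) f8_elts.
    by move: nx0 {x0}; case: x => [[[] []] []].
  by exists y.
by have /eqP := f8_val1; rewrite -xy f8_valM x0 mul0r eq_sym oner_eq0.
Qed.

Lemma f8_val_inj : injective f8_val.
Proof.
move=> x y xy; have /f8_val_eq0 : f8_val (f8_add x y) = 0.
  by rewrite f8_valD xy (addrr_pchar2 (pchar2 cardF)).
by case: x y {xy} => [[[] []] []] [[[] []] []].
Qed.

Lemma f8_val_onto (z : F) : exists x, f8_val x = z.
Proof.
have : codom f8_val =i F.
  by apply: inj_card_onto f8_val_inj _; rewrite cardF !card_prod card_bool.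
by move=> /(_ z); rewrite inE => /codomP[x ->]; exists x.
Qed.

Local Notation Z := (scalarsGL F).

Lemma scalarsGLE (x : {'GL_2[F]}) : (x \in Z) = is_scalar_mx (GLval x).
Proof.
have gs : group_set (scalarsGL_set F).
  apply/group_setP; split=> [|y z]; first by rewrite inE scalar_mx_is_scalar.
  rewrite !inE => /is_scalar_mxP[b yb] /is_scalar_mxP[c zc].
  by apply/is_scalar_mxP; exists (b * c); rewrite [GLval _]/(GLval y *m GLval z) yb zc scalar_mxM.
by rewrite /scalarsGL /= (gen_set_id gs) inE.
Qed.

Lemma SL2E (x : {'GL_2[F]}) : (x \in SL2 F) = (\det (GLval x) == 1).
Proof.
have gs : group_set (SL2_set F).
  apply/group_setP; split=> [|y z]; first by rewrite inE det1.
  by rewrite !inE [GLval (y * z)%g]/(GLval y *m GLval z) det_mulmx => /eqP-> /eqP->; rewrite mulr1.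
by rewrite /SL2 /= (gen_set_id gs) inE.
Qed.

Lemma normGL (x : {'GL_2[F]}) : x \in 'N(Z)%g.
Proof.
apply: (subsetP (cent_sub _)); apply/centP=> y; rewrite scalarsGLE => /is_scalar_mxP[b yb].
by apply: val_inj; change (GLval x *m GLval y = GLval y *m GLval x); rewrite yb scalar_mxC.
Qed.

Definition mx_of (m : sl2) : 'M[F]_2 :=
  let: (p, q, r, s) := m in
  \matrix_(i, j) f8_val (if i == 0 then if j == 0 then p else q
                                   else if j == 0 then r else s).

Lemma mx_ofM m n : mx_of (sl2_mul m n) = mx_of m *m mx_of n.
Proof.
case: m n => [[[p q] r] s] [[[p' q'] r'] s'].
apply/matrixP=> i j; rewrite !mxE !big_ord_recl big_ord0 !mxE /=.
by case: ifP => _; case: ifP => _; rewrite f8_valD !f8_valM addr0.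
Qed.

Lemma det_mx_of m : \det (mx_of m) = f8_val (sl2_det m).
Proof.
case: m => [[[p q] r] s].
rewrite (expand_det_row _ 0) !big_ord_recl big_ord0 /cofactor !det_mx11 !mxE /=.
by rewrite f8_valD !f8_valM expr0 expr1 mul1r mulN1r addr0 (oppr_pchar2 (pchar2 cardF)).
Qed.

(** Total by default: a singular matrix goes to 1, hence the determinant hypotheses in the lemmas on
    [emb]. *)
Definition gl_of (m : sl2) : {'GL_2[F]} := insubd (1%g : {'GL_2[F]}) (mx_of m).
Definition emb (m : sl2) : coset_of Z := coset Z (gl_of m).

Lemma val_gl_of m : sl2_det m = f8_1 -> GLval (gl_of m) = mx_of m.
Proof.
move=> dm; rewrite [GLval _]val_insubd.
by have -> : mx_of m \is a GRing.unit; rewrite // unitmxE det_mx_of dm f8_val1 unitr1.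
Qed.

Lemma det_mul m n : sl2_det m = f8_1 -> sl2_det n = f8_1 -> sl2_det (sl2_mul m n) = f8_1.
Proof.
move=> dm dn; apply: f8_val_inj.
by rewrite -det_mx_of mx_ofM det_mulmx !det_mx_of dm dn f8_val1 mulr1.
Qed.

Lemma embM m n : sl2_det m = f8_1 -> sl2_det n = f8_1 ->
  emb (sl2_mul m n) = (emb m * emb n)%g.
Proof.
move=> dm dn; rewrite /emb -morphM ?normGL //; congr (coset Z _).
apply: val_inj; change (GLval (gl_of (sl2_mul m n)) = GLval (gl_of m) *m GLval (gl_of n)).
by rewrite !val_gl_of ?det_mul // mx_ofM.
Qed.

Lemma mx_of_inj : injective mx_of.
Proof.
move=> [[[p q] r] s] [[[p' q'] r'] s'] /matrixP eq_mn.
have := eq_mn 0 0; have := eq_mn 0 1; have := eq_mn 1 0; have := eq_mn 1 1.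
by rewrite !mxE /=; do 4!move=> /f8_val_inj ->.
Qed.

(** Matrices with the same class differ by a scalar b, and comparing determinants gives b^2 = 1. In
    characteristic 2 this reads (b - 1)^2 = 0, so b = 1. *)
Lemma emb_inj m n : sl2_det m = f8_1 -> sl2_det n = f8_1 -> emb m = emb n -> m = n.
Proof.
move=> dm dn /(kercoset_rcoset (normGL _) (normGL _))[z].
rewrite scalarsGLE => /is_scalar_mxP[b zb] /(congr1 (fun x => GLval x)).
change (GLval (gl_of m) = GLval z *m GLval (gl_of n) -> m = n).
rewrite !val_gl_of // zb mul_scalar_mx => mn; apply: mx_of_inj; rewrite mn.
have /eqP : b ^+ 2 = 1.
  by have := congr1 determinant mn; rewrite detZ !det_mx_of dm dn f8_val1 mulr1.
rewrite -subr_eq0 (_ : b ^+ 2 - 1 = (b - 1) ^+ 2); last first.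
  by rewrite sqrrB1 -[b *+ 2]mulr_natr -[2%:R]/(1 + 1) (add2 cardF) mulr0 subr0 (oppr_pchar2 (pchar2 cardF)).
by rewrite expf_eq0 /= subr_eq0 => /eqP->; rewrite scale1r.
Qed.

Lemma emb_mem m : sl2_det m = f8_1 -> emb m \in PSL2 F.
Proof.
move=> dm; rewrite /emb mem_quotient // SL2E val_gl_of // det_mx_of dm.
by rewrite f8_val1.
Qed.

Lemma emb_onto y : y \in PSL2 F -> exists2 m, sl2_det m = f8_1 & emb m = y.
Proof.
case/morphimP=> x _; rewrite SL2E => /eqP dx ->.
have [p xp] := f8_val_onto (GLval x 0 0); have [q xq] := f8_val_onto (GLval x 0 1).
have [r xr] := f8_val_onto (GLval x 1 0); have [s xs] := f8_val_onto (GLval x 1 1).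
have xm : mx_of (p, q, r, s) = GLval x.
  apply/matrixP=> i j; rewrite mxE; move: i j; do 2!(case; case=> [|[]] // ?) => /=.
  - by rewrite xp; congr (GLval x _ _); apply: val_inj.
  - by rewrite xq; congr (GLval x _ _); apply: val_inj.
  - by rewrite xr; congr (GLval x _ _); apply: val_inj.
  by rewrite xs; congr (GLval x _ _); apply: val_inj.
have dm : sl2_det (p, q, r, s) = f8_1.
  by apply: f8_val_inj; rewrite -det_mx_of xm dx f8_val1.
exists (p, q, r, s) => //; congr (coset _ _); apply: val_inj.
by change (GLval (gl_of (p, q, r, s)) = GLval x); rewrite val_gl_of.
Qed.

End Embedding.

(** * Lattices *)

Lemma eq_mx_delta m n (A B : 'M[int]_(m, n)) :
  (forall j, A *m delta_mx j 0 = B *m delta_mx j 0 :> 'cV_m) -> A = B.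
Proof. by move=> eqAB; apply/matrixP=> i j; have /matrixP/(_ i 0) := eqAB j; rewrite -!colE !mxE. Qed.

Lemma eq_mx_vec m n (A B : 'M[int]_(m, n)) :
  (forall v : 'cV_n, A *m v = B *m v) -> A = B.
Proof. by move=> eqAB; apply: eq_mx_delta. Qed.

Lemma vec_sum n (v : 'cV[int]_n) : v = \sum_j v j 0 *: delta_mx j 0.
Proof. by rewrite [LHS]matrix_sum_delta; apply: eq_bigr => j _; rewrite big_ord1. Qed.

Section LatticeTheory.
Variables (gT : finGroupType) (G : {group gT}).
Implicit Types L M : glat gT.

Lemma lat_iso_refl L : lat_iso G L L.
Proof. by exists 1%:M, 1%:M; rewrite mulmx1; split=> // g _; rewrite mulmx1 mul1mx. Qed.

Lemma equivariant_inv L M (A : 'M_(rk M, rk L)) (B : 'M_(rk L, rk M)) :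
  A *m B = 1%:M -> B *m A = 1%:M -> equivariant G L M A -> equivariant G M L B.
Proof.
move=> AB BA eqvA g Gg.
by rewrite -[LHS]mul1mx -BA -!mulmxA [A *m _]mulmxA -eqvA // -mulmxA AB mulmx1.
Qed.

Lemma lat_iso_sym L M : lat_iso G L M -> lat_iso G M L.
Proof.
by case=> A [B [AB BA eqvA]]; exists B, A; split=> //; apply: equivariant_inv BA eqvA.
Qed.

Lemma lat_iso_trans L M N : lat_iso G L M -> lat_iso G M N -> lat_iso G L N.
Proof.
case=> A [B [AB BA eqvA]] [A' [B' [AB' BA' eqvA']]].
exists (A' *m A), (B *m B'); split.
- by rewrite mulmxA -[A' *m A *m B]mulmxA AB mulmx1.
- by rewrite mulmxA -[B *m B' *m A']mulmxA BA' mulmx1.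
by move=> g Gg; rewrite mulmxA eqvA' // -!mulmxA eqvA.
Qed.

Lemma lat_iso_dsum L L' M M' :
  lat_iso G L L' -> lat_iso G M M' -> lat_iso G (dsum L M) (dsum L' M').
Proof.
case=> A [B [AB BA eqvA]] [A' [B' [AB' BA' eqvA']]].
exists (block_mx A 0 0 A'), (block_mx B 0 0 B'); split.
- by rewrite mulmx_block !(mulmx0, mul0mx, addr0, add0r) AB AB' -scalar_mx_block.
- by rewrite mulmx_block !(mulmx0, mul0mx, addr0, add0r) BA BA' -scalar_mx_block.
by move=> g Gg; rewrite !mulmx_block !(mulmx0, mul0mx, addr0, add0r) eqvA // eqvA'.
Qed.

Lemma lat_iso_dsumC L M : lat_iso G (dsum L M) (dsum M L).
Proof.
exists (block_mx 0 1%:M 1%:M 0), (block_mx 0 1%:M 1%:M 0); split.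
- by rewrite mulmx_block !(mulmx0, mul0mx, addr0, add0r) !mulmx1 -scalar_mx_block.
- by rewrite mulmx_block !(mulmx0, mul0mx, addr0, add0r) !mulmx1 -scalar_mx_block.
by move=> g Gg; rewrite !mulmx_block !(mulmx0, mul0mx, addr0, add0r) !mulmx1 !mul1mx.
Qed.

Lemma lat_iso_dsumA L M N :
  lat_iso G (dsum (dsum L M) N) (dsum L (dsum M N)).
Proof.
pose A : 'M[int]_(rk L + (rk M + rk N), rk L + rk M + rk N) :=
  col_mx (row_mx (row_mx 1%:M 0) 0)
         (col_mx (row_mx (row_mx 0 1%:M) 0) (row_mx (row_mx 0 0) 1%:M)).
pose B : 'M[int]_(rk L + rk M + rk N, rk L + (rk M + rk N)) :=
  col_mx (col_mx (row_mx 1%:M (row_mx 0 0)) (row_mx 0 (row_mx 1%:M 0)))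
         (row_mx 0 (row_mx 0 1%:M)).
have AE x y z : A *m col_mx (col_mx x y) z = col_mx x (col_mx y z) :> 'cV_ _.
  by rewrite !mul_col_mx !mul_row_col !(mul1mx, mul0mx, addr0, add0r).
have BE x y z : B *m col_mx x (col_mx y z) = col_mx (col_mx x y) z :> 'cV_ _.
  by rewrite !mul_col_mx !mul_row_col !(mul1mx, mul0mx, addr0, add0r).
exists A, B; split.
- apply: eq_mx_vec => v; rewrite -mulmxA mul1mx -[v]vsubmxK -[dsubmx v]vsubmxK.
  by rewrite BE AE.
- apply: eq_mx_vec => v; rewrite -mulmxA mul1mx -[v]vsubmxK -[usubmx v]vsubmxK.
  by rewrite AE BE.
move=> g Gg; apply: eq_mx_vec => v; rewrite -!mulmxA -[v]vsubmxK -[usubmx v]vsubmxK.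
by rewrite AE !mul_block_col !(mul0mx, addr0, add0r) AE.
Qed.

Lemma lat_iso_dsum0 L : lat_iso G (dsum L zero_lat) L.
Proof.
exists (row_mx 1%:M 0), (col_mx 1%:M 0); split.
- by rewrite mul_row_col mulmx1 mul0mx addr0.
- apply: eq_mx_vec => v; rewrite -mulmxA mul1mx -[v]vsubmxK.
  rewrite mul_row_col mul_col_mx !mul1mx !mul0mx addr0.
  by congr col_mx; apply/matrixP=> [[]].
by move=> g Gg; rewrite mul_row_block mulmx1 !(mul0mx, mulmx0) !addr0 mul_mx_row mulmx1 mul1mx mulmx0.
Qed.

Lemma is_glat_dsum L M : is_glat G L -> is_glat G M -> is_glat G (dsum L M).
Proof.
move=> [L1 LM] [M1 MM]; split=> [|g h Gg Gh] /=.
  by rewrite L1 M1 -scalar_mx_block.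
by rewrite mulmx_block !(mulmx0, mul0mx, addr0, add0r) LM // MM.
Qed.

Lemma is_glat_zero : is_glat G (@zero_lat gT).
Proof. by split=> // g h _ _; rewrite mulmx1. Qed.

(** The preimages are the columns of a right inverse of [T], and over a commutative ring a right
    inverse of a square matrix is two-sided. *)
Lemma lat_iso_surj L M (T : 'M_(rk M, rk L)) :
  rk L = rk M -> equivariant G L M T ->
  (forall j, exists u : 'cV_(rk L), T *m u = delta_mx j 0) -> lat_iso G L M.
Proof.
move=> eq_rk eqvT /fin_all_exists[u Tu].
pose S : 'M_(rk L, rk M) := \matrix_(i, j) u j i 0.
have TS : T *m S = 1%:M.
  apply: eq_mx_delta => j; rewrite -mulmxA mul1mx -colE (_ : col j S = u j) //.
  by apply/matrixP=> i k; rewrite !mxE ord1.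
(* [T] is square only up to [eq_rk]; generalizing [T] and [S] allows this equality to be rewritten
   in their types. *)
exists T, S; split=> //; move: T S TS {Tu eqvT}; clear u.
by rewrite eq_rk => T S; exact: mulmx1C.
Qed.

(** * Lattices with a permuted basis *)

(* The basis is a family of subsets of the group, permuted by left
   translation; [perm_lat G H] is the case of the enumeration of [lcosets H G]. *)
Definition set_lat n (b : 'I_n -> {set gT}) : glat gT :=
  GLat n (fun g => \matrix_(i, j) (b i == lcoset (b j) g)%:R).

Definition set_basis n (b : 'I_n -> {set gT}) :=
  injective b /\ forall g j, g \in G -> exists i, b i = lcoset (b j) g.

Lemma set_lat_delta n (b : 'I_n -> {set gT}) g i j :
  injective b -> b i = lcoset (b j) g ->
  rep (set_lat b) g *m delta_mx j 0 = delta_mx i 0 :> 'cV_n.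
Proof.
move=> inj_b bij; rewrite -colE; apply/matrixP=> k l.
by rewrite !mxE ord1 -bij eqxx andbT (inj_eq inj_b).
Qed.

Lemma is_glat_set_lat n (b : 'I_n -> {set gT}) :
  set_basis b -> is_glat G (set_lat b).
Proof.
move=> [inj_b st_b]; split=> [|g h Gg Gh]; apply: eq_mx_delta => j.
  by rewrite mul1mx (set_lat_delta inj_b (i := j)) // lcosetE mul1g.
have [i bi] := st_b h j Gh; have [k bk] := st_b g i Gg.
rewrite -mulmxA (set_lat_delta inj_b bi) (set_lat_delta inj_b bk).
by apply: set_lat_delta; rewrite // bk bi !lcosetE mulgA mulg_set1.
Qed.

Definition base_change m n (b : 'I_m -> {set gT}) (b' : 'I_n -> {set gT}) :
  'M[int]_(n, m) := \matrix_(i, j) (b' i == b j)%:R.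

Lemma base_change_delta m n (b : 'I_m -> {set gT}) (b' : 'I_n -> {set gT}) i j :
  injective b' -> b' i = b j ->
  base_change b b' *m delta_mx j 0 = delta_mx i 0 :> 'cV_n.
Proof.
move=> inj_b bij; rewrite -colE; apply/matrixP=> k l.
by rewrite !mxE ord1 -bij eqxx andbT (inj_eq inj_b).
Qed.

Lemma base_changeK m n (b : 'I_m -> {set gT}) (b' : 'I_n -> {set gT}) :
  injective b -> injective b' -> (forall j, exists i, b' i = b j) ->
  base_change b' b *m base_change b b' = 1%:M.
Proof.
move=> inj_b inj_b' sub_b; apply: eq_mx_delta => j; have [i bij] := sub_b j.
by rewrite -mulmxA mul1mx (base_change_delta inj_b' bij) (base_change_delta inj_b (esym bij)).
Qed.

Lemma base_change_eqv m n (b : 'I_m -> {set gT}) (b' : 'I_n -> {set gT}) :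
  set_basis b -> injective b' -> (forall j, exists i, b' i = b j) ->
  equivariant G (set_lat b) (set_lat b') (base_change b b').
Proof.
move=> [inj_b st_b] inj_b' sub_b g Gg; apply: eq_mx_delta => j.
have [i bi] := sub_b j; have [k bk] := st_b g j Gg; have [l bl] := sub_b k.
rewrite -!mulmxA (base_change_delta inj_b' bi) (set_lat_delta inj_b bk).
by rewrite (base_change_delta inj_b' bl); apply: set_lat_delta; rewrite // bl bk bi.
Qed.

Lemma const_mx_delta m n (j : 'I_n) :
  const_mx 1 *m delta_mx j 0 = const_mx 1 :> 'M[int]_(m, 1).
Proof. by rewrite -colE; apply/matrixP=> i k; rewrite !mxE. Qed.

(** The last condition says that the isomorphism respects the sum of coordinates, so it matches the
    augmentation kernels of the two lattices. *)
Definition sum_iso L M :=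
  exists (A : 'M[int]_(rk M, rk L)) (B : 'M[int]_(rk L, rk M)),
    [/\ A *m B = 1%:M, B *m A = 1%:M, equivariant G L M A
      & const_mx 1 *m A = const_mx 1 :> 'rV_(rk L)].

Lemma sum_iso_lat_iso L M : sum_iso L M -> lat_iso G L M.
Proof. by case=> A [B [AB BA eqvA _]]; exists A, B. Qed.

Lemma set_lat_iso m n (b : 'I_m -> {set gT}) (b' : 'I_n -> {set gT}) :
  set_basis b -> injective b' -> (forall j, exists i, b' i = b j) ->
  (forall i, exists j, b j = b' i) -> sum_iso (set_lat b) (set_lat b').
Proof.
move=> bas_b inj_b' sub_b sub_b'; have [inj_b _] := bas_b.
exists (base_change b b'), (base_change b' b); split;
  [exact: base_changeK | exact: base_changeK | exact: base_change_eqv | ].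
apply: eq_mx_delta => j; have [i bi] := sub_b j.
by rewrite -mulmxA (base_change_delta inj_b' bi) !const_mx_delta.
Qed.

Lemma set_basis_lcosets (H : {group gT}) :
  H \subset G -> set_basis (@enum_val _ (mem (lcosets H G))).
Proof.
move=> sHG; split=> [|g j Gg]; first exact: enum_val_inj.
have /lcosetsP[x Gx xH] := enum_valP j.
have gxH : lcoset (enum_val j) g \in lcosets H G.
  by rewrite xH lcosetE mulgA mulg_set1; apply/lcosetsP; exists (g * x)%g; rewrite ?groupM // lcosetE.
by exists (enum_rank_in gxH (lcoset (enum_val j) g)); rewrite enum_rankK_in.
Qed.

Lemma is_glat_perm_lat (H : {group gT}) :
  H \subset G -> is_glat G (perm_lat G H).
Proof. by move=> sHG; apply: is_glat_set_lat (set_basis_lcosets sHG). Qed.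

(* Right translation by [x] identifies the left cosets of [H] with those of
   [H :^ x]. *)
Lemma set_lat_perm_iso (H : {group gT}) x n (b : 'I_n -> {set gT}) :
  H \subset G -> x \in G -> injective b ->
  (forall j, exists2 y, y \in G & b j = lcoset H y) ->
  (forall y, y \in G -> exists j, b j = lcoset H y) ->
  sum_iso (set_lat b) (perm_lat G (H :^ x)%G).
Proof.
move=> sHG Gx inj_b b_lc lc_b; pose b' j := rcoset (b j) x.
have inj_b' : injective b' by move=> i j; rewrite /b' !rcosetE => /rcoset_inj/inj_b.
have lrE (A : {set gT}) g : lcoset (rcoset A x) g = rcoset (lcoset A g) x.
  by rewrite !lcosetE !rcosetE mulgA.
have HxE y : lcoset (H :^ x)%G (y * x)%g = rcoset (lcoset H y) x.
  by rewrite !lcosetE !rcosetE /= conjsgE !mulgA mulg_set1 mulgK.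
have bas_b' : set_basis b'.
  split=> // g j Gg; have [y Gy bj] := b_lc j; have [i bi] := lc_b _ (groupM Gg Gy).
  by exists i; rewrite /b' lrE bi bj !lcosetE mulgA mulg_set1.
suff [A [B [AB BA eqvA oneA]]] :
    sum_iso (set_lat b') (set_lat (@enum_val _ (mem (lcosets (H :^ x)%G G)))).
  (* Right translation is injective and commutes with left translation, so [b] and [b'] give the
     same matrices. *)
  exists A, B; split=> // g Gg; rewrite -[rep (set_lat b) g](_ : rep (set_lat b') g = _).
    exact: eqvA.
  by apply/matrixP=> i j; rewrite !mxE lrE /b' !rcosetE (inj_eq (@rcoset_inj _ _)).
apply: (set_lat_iso bas_b' (@enum_val_inj _ _)) => [j|i].
  have [y Gy bj] := b_lc j.
  have yH : b' j \in lcosets (H :^ x)%G G.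
    by rewrite /b' bj -HxE; apply/lcosetsP; exists (y * x)%g; rewrite ?groupM // lcosetE.
  by exists (enum_rank_in yH (b' j)); rewrite enum_rankK_in.
have /lcosetsP[y Gy ->] := enum_valP i.
have [j bj] := lc_b (y * x^-1)%g (groupM Gy (groupVr Gx)).
by exists j; rewrite /b' bj -HxE mulgKV lcosetE.
Qed.

(** Permutation matrices are orthogonal: a lattice with a permuted basis is its own dual. *)
Lemma set_lat_tr n (b : 'I_n -> {set gT}) g :
  (rep (set_lat b) g^-1)^T = rep (set_lat b) g.
Proof.
apply/matrixP=> i j; rewrite !mxE; congr (nat_of_bool _)%:R.
rewrite -(inj_eq (@lcoset_inj _ g)) !lcosetE mulgA mulg_set1 mulgV mul1g.
by rewrite eq_sym.
Qed.

(** Frobenius reciprocity: an equivariant map out of Z[G/H] is determined by the image [w] of the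
    base coset, which can be any vector fixed by [H]. *)
Lemma orbit_mx_eqv (H : {group gT}) L n (b : 'I_n -> {set gT}) (r : 'I_n -> gT)
    (w : 'cV_(rk L)) :
  is_glat G L -> H \subset G -> set_basis b -> (forall j, r j \in G) ->
  (forall j, b j = lcoset H (r j)) -> (forall h, h \in H -> rep L h *m w = w) ->
  equivariant G (set_lat b) L (\matrix_(i, j) (rep L (r j) *m w) i 0).
Proof.
set T : 'M_(_, _) := \matrix_(i, j) _.
move=> [L1 LM] sHG [inj_b st_b] Gr bE fix_w g Gg.
have TE j : T *m delta_mx j 0 = rep L (r j) *m w.
  by rewrite -colE; apply/matrixP=> i k; rewrite !mxE ord1.
apply: eq_mx_delta => j; have [i bi] := st_b g j Gg.
rewrite -!mulmxA (set_lat_delta inj_b bi) !TE mulmxA -LM ?Gr //.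
have : r i \in lcoset H (g * r j)%g.
  by rewrite lcosetE -mulg_set1 -mulgA -!lcosetE -bE -bi bE lcosetE lcoset_refl.
rewrite lcosetE => /lcosetP[h Hh ->].
have Gh := subsetP sHG h Hh.
have Ggr := groupM Gg (Gr j); rewrite (LM _ _ Ggr Gh) -mulmxA.
by rewrite (fix_w _ Hh).
Qed.

Lemma row_mx_eqv L M N (A : 'M_(rk N, rk L)) (B : 'M_(rk N, rk M)) :
  equivariant G L N A -> equivariant G M N B ->
  equivariant G (dsum L M) N (row_mx A B).
Proof.
move=> eqvA eqvB g Gg.
by rewrite mul_mx_row mul_row_block !mulmx0 addr0 add0r eqvA // eqvB.
Qed.

(** * Vanishing of the Tate group in degree -1 *)

(** Let N send each basis vector to the chosen representative of its [K]-orbit. Modulo the vectors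
    (h - 1) y with h in [K], x is congruent to N x. Since N is constant on orbits, applying it to
    the norm of x gives |K| N x = 0, hence N x = 0 as the lattice has no torsion. *)
Lemma tateHm1_set_lat (K : {group gT}) n (b : 'I_n -> {set gT}) :
  set_basis b -> K \subset G -> tateHm1_trivial K (set_lat b).
Proof.
move=> bas_b sKG x Nx0; have [inj_b st_b] := bas_b.
have [L1 LM] := is_glat_set_lat bas_b.
pose e i j := [exists h in K, b i == lcoset (b j) h].
have eP i j : reflect (exists2 h, h \in K & b i = lcoset (b j) h) (e i j).
  by apply: (iffP exists_inP) => -[h Kh /eqP]; exists h => //; apply/eqP.
have e_refl j : e j j by apply/eP; exists 1%g; rewrite ?lcosetE ?mul1g.
have e_sym i j : e i j -> e j i.
  case/eP=> h Kh bi; apply/eP; exists h^-1%g; rewrite ?groupV // bi !lcosetE.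
  by rewrite mulgA mulg_set1 mulVg mul1g.
have e_trans i j k : e i j -> e j k -> e i k.
  case/eP=> h Kh bi /eP[h' Kh' bj]; apply/eP; exists (h * h')%g; rewrite ?groupM //.
  by rewrite bi bj !lcosetE mulgA mulg_set1.
(* [pick] depends only on the values of the predicate, so equivalent indices get the same
   representative; the default never occurs, as [e] is reflexive. *)
pose root j := odflt j [pick i | e i j].
have rootE i j : e i j -> root i = root j.
  move=> eij; rewrite /root (@eq_pick _ _ (e^~ j)); last first.
    by move=> k; apply/idP/idP=> ek; [apply: e_trans ek eij | apply: e_trans ek (e_sym _ _ eij)].
  by case: pickP => // /(_ j); rewrite e_refl.
have root_e j : e j (root j).
  by rewrite /root; case: pickP => [i eij | _]; rewrite ?e_refl // e_sym.
have /fin_all_exists2[h_ Kh hE] : forall j, exists2 h, h \in K & b j = lcoset (b (root j)) h.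
  by move=> j; apply/eP.
pose N : 'M[int]_n := \matrix_(i, j) (i == root j)%:R.
have NE j : N *m delta_mx j 0 = delta_mx (root j) 0 :> 'cV_n.
  by rewrite -colE; apply/matrixP=> i k; rewrite !mxE ord1 eqxx andbT.
have NK h : h \in K -> N *m rep (set_lat b) h = N.
  move=> Kh'; apply: eq_mx_delta => j; have [i bi] := st_b h j (subsetP sKG h Kh').
  rewrite -mulmxA (set_lat_delta inj_b bi) !NE; congr delta_mx.
  by apply: rootE; apply/eP; exists h.
have Nx : N *m x = 0.
  have := congr1 (mulmx N) Nx0; rewrite mulmx0 mulmx_sumr.
  rewrite (eq_bigr (fun _ => N *m x)) => [|h Kh']; last by rewrite mulmxA NK.
  rewrite sumr_const => /matrixP eq0; apply/matrixP=> i k; apply/eqP.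
  have /eqP := eq0 i k; rewrite mulmxnE [X in _ == X]mxE mulrn_eq0 => /orP[|].
    by rewrite -leqn0 leqNgt cardG_gt0.
  by rewrite [X in _ -> _ == X]mxE.
(* Each e_j - e_(root j) equals (h_j - 1) e_(root j); the terms are grouped by the value of [h_]. *)
exists (fun h => \sum_(j | h_ j == h) x j 0 *: delta_mx (root j) 0).
rewrite (eq_bigr (fun h => \sum_(j | h_ j == h) x j 0 *: (delta_mx j 0 - delta_mx (root j) 0))); last first.
  move=> h _; rewrite mulmx_sumr; apply: eq_bigr => j /eqP <-.
  by rewrite -scalemxAr mulmxBl mul1mx (set_lat_delta inj_b (hE j)).
transitivity (\sum_j x j 0 *: (delta_mx j 0 - delta_mx (root j) 0) : 'cV[int]_n); last first.
  by rewrite (partition_big h_ (mem K)) //= => j _; apply: Kh.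
rewrite (eq_bigr (fun j => x j 0 *: delta_mx j 0 - N *m (x j 0 *: delta_mx j 0))); last first.
  by move=> j _; rewrite -scalemxAr NE scalerBr.
by rewrite sumrB -mulmx_sumr -vec_sum Nx subr0.
Qed.

Lemma tateHm1_map (K : {group gT}) L M (A : 'M_(rk M, rk L)) (y : gT -> 'cV_(rk L)) :
  K \subset G -> equivariant G L M A ->
  A *m (\sum_(h in K) (rep L h - 1%:M) *m y h) = \sum_(h in K) (rep M h - 1%:M) *m (A *m y h).
Proof.
move=> sKG eqvA; rewrite mulmx_sumr; apply: eq_bigr => h Kh.
by rewrite !mulmxA; congr (_ *m _); rewrite mulmxBr mulmxBl mulmx1 mul1mx eqvA ?(subsetP sKG).
Qed.

Lemma norm_map (K : {group gT}) L M (A : 'M_(rk M, rk L)) (x : 'cV_(rk L)) :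
  K \subset G -> equivariant G L M A ->
  \sum_(h in K) rep L h *m x = 0 -> \sum_(h in K) rep M h *m (A *m x) = 0.
Proof.
move=> sKG eqvA x0; rewrite (eq_bigr (fun h => A *m (rep L h *m x))) => [|h Kh].
  by rewrite -mulmx_sumr x0 mulmx0.
by rewrite !mulmxA eqvA ?(subsetP sKG).
Qed.

Lemma tateHm1_retract (K : {group gT}) L M (A : 'M_(rk M, rk L)) (B : 'M_(rk L, rk M)) :
  K \subset G -> equivariant G L M A -> equivariant G M L B -> B *m A = 1%:M ->
  tateHm1_trivial K M -> tateHm1_trivial K L.
Proof.
move=> sKG eqvA eqvB BA tM x /(norm_map sKG eqvA)/tM[y yE].
exists (fun h => B *m y h).
by rewrite -(tateHm1_map y sKG eqvB) -yE mulmxA BA mul1mx.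
Qed.

Definition inl_mx L M : 'M[int]_(rk (dsum L M), rk L) := col_mx 1%:M 0.
Definition inr_mx L M : 'M[int]_(rk (dsum L M), rk M) := col_mx 0 1%:M.
Definition prl_mx L M : 'M[int]_(rk L, rk (dsum L M)) := row_mx 1%:M 0.
Definition prr_mx L M : 'M[int]_(rk M, rk (dsum L M)) := row_mx 0 1%:M.

Lemma inl_mx_eqv L M : equivariant G L (dsum L M) (inl_mx L M).
Proof. by move=> g _; rewrite mul_block_col mul_col_mx !(mulmx1, mulmx0, mul1mx, mul0mx, addr0). Qed.
Lemma inr_mx_eqv L M : equivariant G M (dsum L M) (inr_mx L M).
Proof. by move=> g _; rewrite mul_block_col mul_col_mx !(mulmx1, mulmx0, mul1mx, mul0mx, add0r). Qed.
Lemma prl_mx_eqv L M : equivariant G (dsum L M) L (prl_mx L M).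
Proof. by move=> g _; rewrite mul_row_block mul_mx_row !(mulmx1, mulmx0, mul1mx, mul0mx, addr0). Qed.
Lemma prr_mx_eqv L M : equivariant G (dsum L M) M (prr_mx L M).
Proof. by move=> g _; rewrite mul_row_block mul_mx_row !(mulmx1, mulmx0, mul1mx, mul0mx, add0r). Qed.

Lemma tateHm1_dsum (K : {group gT}) L M : K \subset G ->
  tateHm1_trivial K L -> tateHm1_trivial K M -> tateHm1_trivial K (dsum L M).
Proof.
move=> sKG tL tM x Nx.
have [y yE] := tL _ (norm_map sKG (@prl_mx_eqv L M) Nx).
have [z zE] := tM _ (norm_map sKG (@prr_mx_eqv L M) Nx).
exists (fun h => inl_mx L M *m y h + inr_mx L M *m z h).
under eq_bigr do rewrite mulmxDr; rewrite big_split /=.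
rewrite -(tateHm1_map y sKG (@inl_mx_eqv L M)) -(tateHm1_map z sKG (@inr_mx_eqv L M)).
rewrite -yE -zE -[x]vsubmxK !mul_row_col !mul_col_mx.
by rewrite !(mul1mx, mul0mx, addr0, add0r) add_col_mx addr0 add0r.
Qed.

Lemma tateHm1_iso (K : {group gT}) L M : K \subset G ->
  lat_iso G L M -> tateHm1_trivial K M -> tateHm1_trivial K L.
Proof.
move=> sKG [A [B [AB BA eqvA]]].
exact: tateHm1_retract sKG eqvA (equivariant_inv AB BA eqvA) BA.
Qed.

Lemma tateHm1_dsum_r (K : {group gT}) L M : K \subset G ->
  tateHm1_trivial K (dsum L M) -> tateHm1_trivial K M.
Proof.
move=> sKG; apply: (tateHm1_retract sKG (@inr_mx_eqv L M) (@prr_mx_eqv L M)).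
by rewrite mul_row_col mul0mx add0r mulmx1.
Qed.
End LatticeTheory.

(** * The flabby resolution *)

Section Resolution.
Variables (gT : finGroupType) (G : {group gT}) (k m : nat).
Variables (b : 'I_(k + 1) -> {set gT}) (bP : 'I_(m + k) -> {set gT}).
Hypotheses (bas_b : set_basis G b) (bas_bP : set_basis G bP).
Local Notation V := (set_lat b).
Local Notation P := (set_lat bP).

(** The columns are the differences between each basis vector and the last one, a basis of the
    vectors of sum 0; coordinates in it are read off by forgetting the last entry. *)
Definition aug_in : 'M[int]_(k + 1, k) := col_mx 1%:M (const_mx (-1)).
Definition aug_out : 'M[int]_(k, k + 1) := row_mx 1%:M 0.

Definition aug_lat : glat gT := GLat k (fun g => aug_out *m rep V g *m aug_in).

Lemma aug_latE g : rep aug_lat g = aug_out *m rep V g *m aug_in.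
Proof. by []. Qed.

Lemma aug_inK : aug_out *m aug_in = 1%:M.
Proof. by rewrite mul_row_col mulmx1 mul0mx addr0. Qed.

Lemma one_mul_col n (X : 'M[int]_(k, n)) (y : 'M[int]_(1, n)) :
  const_mx 1 *m col_mx X y = const_mx 1 *m X + y :> 'rV_n.
Proof.
rewrite -[const_mx 1](row_mx_const 1 k 1) mul_row_col; congr (_ + _).
by rewrite -[RHS]mul1mx; congr (_ *m _); apply/matrixP=> i j; rewrite !mxE !ord1.
Qed.

Lemma one_aug_in : const_mx 1 *m aug_in = 0 :> 'rV_k.
Proof.
by rewrite one_mul_col mulmx1; apply/matrixP=> i j; rewrite !mxE subrr.
Qed.

Lemma aug_outK n (X : 'M[int]_(k + 1, n)) :
  const_mx 1 *m X = 0 :> 'rV_n -> aug_in *m (aug_out *m X) = X.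
Proof.
rewrite -[X]vsubmxK mul_row_col mul1mx mul0mx addr0 mul_col_mx mul1mx one_mul_col.
move/eqP; rewrite addrC addr_eq0 => /eqP ->; congr col_mx.
by rewrite -mulNmx; congr (_ *m _); apply/matrixP=> i j; rewrite !mxE.
Qed.

Lemma one_set_lat n (c : 'I_n -> {set gT}) g : set_basis G c -> g \in G ->
  const_mx 1 *m rep (set_lat c) g = const_mx 1 :> 'rV_n.
Proof.
move=> [inj_c st_c] Gg; apply: eq_mx_delta => j; have [i ci] := st_c g j Gg.
by rewrite -mulmxA (set_lat_delta inj_c ci) !const_mx_delta.
Qed.

Lemma aug_in_eqv : equivariant G aug_lat V aug_in.
Proof.
move=> g Gg; rewrite aug_latE -!mulmxA aug_outK // mulmxA.
by rewrite one_set_lat // one_aug_in.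
Qed.

Lemma is_glat_aug_lat : is_glat G aug_lat.
Proof.
have [V1 VM] := is_glat_set_lat bas_b; split=> [|g h Gg Gh].
  by rewrite aug_latE V1 mulmx1 aug_inK.
rewrite [LHS]aug_latE VM // mulmxA -mulmxA (aug_in_eqv Gh) mulmxA.
by rewrite -aug_latE.
Qed.

Lemma is_augmentation_aug_lat (H : {group gT}) :
  sum_iso G V (perm_lat G H) -> is_augmentation_lat G H aug_lat.
Proof.
case=> C [C' [CC' C'C eqvC oneC]]; split; first exact: is_glat_aug_lat.
have oneC' : const_mx 1 *m C' = const_mx 1 :> 'rV_(rk (perm_lat G H)).
  by rewrite -oneC -mulmxA CC' mulmx1.
have sumE n (y : 'cV[int]_n) : (\sum_i y i 0 = 0) <-> const_mx 1 *m y = 0 :> 'M_1.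
  have yE : (const_mx 1 *m y : 'M_1) 0 0 = \sum_i y i 0.
    by rewrite mxE; apply: eq_bigr => i _; rewrite mxE mul1r.
  split=> [y0 | /matrixP/(_ 0 0)]; last by rewrite yE mxE.
  by apply/matrixP=> i j; rewrite !ord1 yE y0 mxE.
exists (C *m aug_in); split.
- move=> g Gg; rewrite mulmxA eqvC // -!mulmxA; congr (C *m _).
  exact: aug_in_eqv.
- move=> x Cx0; rewrite -[x]mul1mx -aug_inK -[aug_in]mul1mx -C'C -!mulmxA.
  by rewrite [C *m _]mulmxA Cx0 !mulmx0.
move=> y; split=> [[x ->] | /sumE y0].
  by apply/sumE; rewrite !mulmxA oneC one_aug_in mul0mx.
exists (aug_out *m (C' *m y)); rewrite -mulmxA aug_outK.
  by rewrite mulmxA CC' mul1mx.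
by rewrite mulmxA oneC'.
Qed.

(* [D] presents the permutation lattice [P] over the augmentation lattice; the
   dual embedding has cokernel spanned by the first [m] basis vectors of [P]. *)
Variable D : 'M[int]_(k + 1, m + k).
Hypothesis eqvD : equivariant G P V D.
Hypothesis oneD : const_mx 1 *m D = 0 :> 'rV_(m + k).
Hypothesis D_split : rsubmx (aug_out *m D) = 1%:M.

Local Notation J := (dual_lat aug_lat).
Definition res_in : 'M[int]_(m + k, k) := (aug_out *m D)^T.
(** By [D_split] the matrix [res_in] ends with an identity block, so the first m basis vectors span
    a complement of its image. [res_out] projects onto that complement along the image; its section
    [res_sec] is integral but need not be equivariant. *)
Definition res_out : 'M[int]_(m, m + k) := row_mx 1%:M (- usubmx res_in).
Definition res_sec : 'M[int]_(m + k, m) := col_mx 1%:M 0.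

Definition quo_lat : glat gT := GLat m (fun g => res_out *m rep P g *m res_sec).

Lemma quo_latE g : rep quo_lat g = res_out *m rep P g *m res_sec.
Proof. by []. Qed.

Lemma is_glat_dual L : is_glat G L -> is_glat G (dual_lat L).
Proof.
move=> [L1 LM]; split=> [|g h Gg Gh] /=; first by rewrite invg1 L1 trmx1.
by rewrite invMg LM ?groupV // trmx_mul.
Qed.

Lemma res_in_eqv : equivariant G J P res_in.
Proof.
move=> g Gg.
have : aug_out *m D *m rep P g^-1 = rep aug_lat g^-1 *m (aug_out *m D).
  by rewrite aug_latE -!mulmxA aug_outK // eqvD ?groupV.
move/(congr1 trmx); rewrite trmx_mul set_lat_tr => ->.
by rewrite trmx_mul.
Qed.

Lemma res_inE : res_in = col_mx (usubmx res_in) 1%:M.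
Proof.
rewrite -[LHS]vsubmxK; congr col_mx.
by rewrite /res_in -trmx_rsub D_split trmx1.
Qed.

Lemma res_outK : res_out *m res_sec = 1%:M.
Proof. by rewrite mul_row_col mulmx1 mulmx0 addr0. Qed.

Lemma res_out_in : res_out *m res_in = 0.
Proof. by rewrite res_inE mul_row_col mul1mx mulmx1 subrr. Qed.

Lemma res_split : res_sec *m res_out + res_in *m row_mx 0 1%:M = 1%:M.
Proof.
rewrite res_inE !mul_col_mx !mul_mx_row !mulmx1 !mulmx0.
by rewrite add_col_mx !mul1mx !mul0mx !add_row_mx !addr0 !add0r addNr -/(block_mx _ _ _ _) -scalar_mx_block.
Qed.

Lemma res_secK : res_sec *m res_out = 1%:M - res_in *m row_mx 0 1%:M.
Proof. by rewrite -res_split addrK. Qed.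

Lemma res_out_eqv : equivariant G P quo_lat res_out.
Proof.
move=> g Gg; rewrite quo_latE -!mulmxA.
rewrite res_secK !mulmxBr mulmx1 [rep P g *m _]mulmxA res_in_eqv //.
by rewrite -[_ *m rep J g *m _]mulmxA [res_out *m (res_in *m _)]mulmxA res_out_in mul0mx subr0.
Qed.

Lemma is_glat_quo_lat : is_glat G quo_lat.
Proof.
have [P1 PM] := is_glat_set_lat bas_bP; split=> [|g h Gg Gh].
  by rewrite quo_latE P1 mulmx1 res_outK.
rewrite [LHS]quo_latE PM // mulmxA -(res_out_eqv Gg) -mulmxA -mulmxA.
by rewrite [res_out *m _]mulmxA -quo_latE.
Qed.

Lemma quo_lat_resolution : permutation_lat G P -> flabby G quo_lat ->
  flabby_resolution G J P quo_lat res_in res_out.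
Proof.
move=> permP flF; split; first exact/is_glat_dual/is_glat_aug_lat.
have inK : row_mx 0 1%:M *m res_in = 1%:M by rewrite res_inE mul_row_col mul0mx add0r mulmx1.
split; first exact: permP.
split; first exact: flF.
split; first exact: res_in_eqv.
split; first exact: res_out_eqv.
split; first by move=> x x0; rewrite -[x]mul1mx -inK -mulmxA x0 mulmx0.
split; first by move=> z; exists (res_sec *m z); rewrite mulmxA res_outK mul1mx.
move=> y; split=> [y0 | [x ->]]; last by rewrite mulmxA res_out_in mul0mx.
exists (row_mx 0 1%:M *m y); rewrite -[LHS]mul1mx -res_split mulmxDl.
by rewrite -!mulmxA y0 mulmx0 add0r.
Qed.

(** A map that kills the embedded lattice factors through the quotient, and the factor is its
    restriction to the first m basis vectors. *)
Lemma quo_mapK p (T : 'M_(p, m + k)) : T *m res_in = 0 -> lsubmx T *m res_out = T.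
Proof.
move=> T0; have -> : lsubmx T = T *m res_sec.
  by rewrite -[T in RHS]hsubmxK mul_row_col mulmx1 mulmx0 addr0.
by rewrite -mulmxA res_secK mulmxBr mulmx1 mulmxA T0 mul0mx subr0.
Qed.

Lemma quo_map_eqv L (T : 'M_(rk L, m + k)) :
  equivariant G P L T -> T *m res_in = 0 -> equivariant G quo_lat L (lsubmx T).
Proof.
move=> eqvT T0 g Gg; rewrite quo_latE !mulmxA quo_mapK // -eqvT // -mulmxA.
by congr (_ *m _); rewrite -[T in RHS]hsubmxK mul_row_col mulmx1 mulmx0 addr0.
Qed.
End Resolution.

(** * Subgroups of the model *)

Definition is_sl2 (m : sl2) := sl2_det m == f8_1.
Definition pows (m : sl2) n : seq sl2 := traject (sl2_mul m) sl2_one n.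

Definition alpha : f8 := (false, true, false).
(** [cC] generates a nonsplit torus, of order 9, and [cD] a split one, of order 7. The involution
    [cT] inverts both, so it serves for both dihedral groups. *)
Definition cC : sl2 := (f8_0, f8_1, f8_1, alpha).
Definition cD : sl2 := (alpha, f8_0, f8_0, (true, false, true)).
Definition cT : sl2 := (f8_0, f8_1, f8_1, f8_0).
Definition cC3 : sl2 := sl2_mul cC (sl2_mul cC cC).
Definition cU (x : f8) : sl2 := (f8_1, x, f8_0, f8_1).

Definition hC3 := Eval vm_compute in pows cC3 3.
Definition hC9 := Eval vm_compute in pows cC 9.
Definition hC7 := Eval vm_compute in pows cD 7.
Definition hD9 := Eval vm_compute in hC9 ++ [seq sl2_mul cT m | m <- hC9].
Definition hD7 := Eval vm_compute in hC7 ++ [seq sl2_mul cT m | m <- hC7].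
Definition hS := Eval vm_compute in [seq cU x | x <- f8_elts].
Definition hB := Eval vm_compute in [seq sl2_mul m n | m <- hC7, n <- hS].

Definition groupb (hs : seq sl2) :=
  [&& all is_sl2 hs, uniq hs, sl2_one \in hs & all (fun m => all (fun n => sl2_mul m n \in hs) hs) hs].
Definition normb (hs : seq sl2) m := all (fun n => sl2_mul (sl2_mul (sl2_inv m) n) m \in hs) hs.

Lemma groupb_C3 : groupb hC3. Proof. by vm_compute. Qed.
Lemma groupb_C9 : groupb hC9. Proof. by vm_compute. Qed.
Lemma groupb_C7 : groupb hC7. Proof. by vm_compute. Qed.
Lemma groupb_D9 : groupb hD9. Proof. by vm_compute. Qed.
Lemma groupb_D7 : groupb hD7. Proof. by vm_compute. Qed.
Lemma groupb_S : groupb hS. Proof. by vm_compute. Qed.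
Lemma groupb_B : groupb hB. Proof. by vm_compute. Qed.

Lemma normb_C9 : all (fun m => normb hC9 m == (m \in hD9)) sl2_elts.
Proof. by vm_compute. Qed.
Lemma normb_C7 : all (fun m => normb hC7 m == (m \in hD7)) sl2_elts.
Proof. by vm_compute. Qed.
Lemma normb_S : all (fun m => normb hS m == (m \in hB)) sl2_elts.
Proof. by vm_compute. Qed.

Lemma sl2_inv_check : all (fun m => (sl2_mul m (sl2_inv m) == sl2_one) && is_sl2 (sl2_inv m)) sl2_elts.
Proof. by vm_compute. Qed.

(** * Transfer of the explicit subgroups to the group, and their conjugacy *)

Section Model.
Variables (gT : finGroupType) (G : {group gT}) (e : sl2 -> gT).
Hypothesis eM : forall m n, sl2_det m = f8_1 -> sl2_det n = f8_1 -> e (sl2_mul m n) = (e m * e n)%g.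
Hypothesis e_inj : forall m n, sl2_det m = f8_1 -> sl2_det n = f8_1 -> e m = e n -> m = n.
Hypothesis eG : forall m, sl2_det m = f8_1 -> e m \in G.
Hypothesis e_onto : forall y, y \in G -> exists2 m, sl2_det m = f8_1 & e m = y.

Lemma e1 : e sl2_one = 1%g.
Proof. by apply: (mulgI (e sl2_one)); rewrite mulg1 -eM. Qed.

Definition img (hs : seq sl2) : {set gT} := [set x in [seq e m | m <- hs]].
Definition imgG hs : {group gT} := <<img hs>>%G.

Lemma mem_img hs m : all is_sl2 hs -> sl2_det m = f8_1 -> (e m \in img hs) = (m \in hs).
Proof.
move=> /allP hs1 m1; rewrite inE; apply/mapP/idP=> [[n hn] | hm]; last by exists m.
by move/(e_inj m1 (eqP (hs1 _ hn))) ->.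
Qed.

Lemma imgP hs x : reflect (exists2 m, m \in hs & x = e m) (x \in img hs).
Proof. by rewrite inE; apply: mapP. Qed.

Lemma card_img hs : all is_sl2 hs -> uniq hs -> #|img hs| = size hs.
Proof.
move=> /allP hs1 u_hs; rewrite cardsE; apply: etrans (size_map e hs); apply/card_uniqP.
by rewrite map_inj_in_uniq // => m n hm hn; apply: e_inj; apply/eqP/hs1.
Qed.

Lemma imgGE hs : groupb hs -> imgG hs = img hs :> {set gT}.
Proof.
case/and4P=> /allP hs1 _ h1 /allP hM; apply: gen_set_id; apply/group_setP; split.
  by apply/imgP; exists sl2_one; rewrite ?e1.
move=> _ _ /imgP[m hm ->] /imgP[n hn ->]; apply/imgP; exists (sl2_mul m n).
  exact: (allP (hM _ hm)).
by rewrite eM //; apply/eqP/hs1.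
Qed.

Lemma mem_imgG hs m : groupb hs -> sl2_det m = f8_1 -> (e m \in imgG hs) = (m \in hs).
Proof.
move=> hg m1; change (e m \in (imgG hs : {set gT}) = (m \in hs)); rewrite (imgGE hg).
by case/and4P: hg => hs1 *; apply: mem_img.
Qed.

Lemma card_imgG hs : groupb hs -> #|imgG hs| = size hs.
Proof. by move=> hg; rewrite imgGE //; case/and4P: hg => *; apply: card_img. Qed.

Lemma imgG_sub hs : groupb hs -> imgG hs \subset G.
Proof.
move=> hg; rewrite imgGE //; case/and4P: hg => /allP hs1 _ _ _.
by apply/subsetP=> _ /imgP[m hm ->]; apply/eG/eqP/hs1.
Qed.

Lemma imgG_subset hs hs' : groupb hs -> groupb hs' -> {subset hs <= hs'} -> imgG hs \subset imgG hs'.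
Proof.
move=> hg hg' s; rewrite !imgGE //; apply/subsetP=> _ /imgP[m hm ->].
by apply/imgP; exists m => //; apply: s.
Qed.

Lemma oG : #|G| = 504%N.
Proof.
rewrite -size_sl2_elts -(card_img _ uniq_sl2_elts); last first.
  by apply/allP=> m; rewrite sl2_enum.
apply: eq_card => x; apply/idP/imgP=> [/e_onto[m m1 <-] | [m m1 ->]].
  by exists m; rewrite // sl2_enum m1.
by apply/eG/eqP; rewrite -sl2_enum.
Qed.

Lemma eV m : sl2_det m = f8_1 -> e (sl2_inv m) = (e m)^-1%g.
Proof.
move=> m1; have /andP[/eqP mV /eqP mV1] : (sl2_mul m (sl2_inv m) == sl2_one) && is_sl2 (sl2_inv m).
  by apply: (allP sl2_inv_check); rewrite sl2_enum m1.
by apply: (mulgI (e m)); rewrite mulgV -eM // mV e1.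
Qed.

Lemma det1V m : sl2_det m = f8_1 -> sl2_det (sl2_inv m) = f8_1.
Proof.
move=> m1; have mG : m \in sl2_elts by rewrite sl2_enum m1.
by have /andP[_ /eqP] := allP sl2_inv_check _ mG.
Qed.

Hypothesis det1M : forall m n, sl2_det m = f8_1 -> sl2_det n = f8_1 -> sl2_det (sl2_mul m n) = f8_1.

Lemma normalizer_imgG hs hs' : groupb hs -> groupb hs' ->
  all (fun m => normb hs m == (m \in hs')) sl2_elts -> 'N_G(imgG hs)%g = imgG hs' :> {set gT}.
Proof.
move=> hg hg' /allP hN; have /and4P[/allP hs1 _ _ _] := hg.
apply/setP=> x; rewrite inE; apply/andP/idP=> [[/e_onto[m m1 <-]] | hx].
  move=> Nm; rewrite mem_imgG // -(eqP (hN m _)) ?sl2_enum ?m1 //.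
  apply/allP=> n hn; have n1 := eqP (hs1 _ hn).
  have mV1 := det1V m1.
  rewrite -mem_imgG ?det1M // !eM ?det1M // eV // -mulgA -conjgE memJ_norm //.
  by rewrite mem_imgG.
have Gx := subsetP (imgG_sub hg') x hx; split=> //.
have [m m1 xm] := e_onto Gx; have mV1 := det1V m1.
have nm : normb hs m by rewrite (eqP (hN m _)) ?sl2_enum ?m1 // -mem_imgG // xm.
rewrite inE; apply/subsetP=> _ /imsetP[y hy ->].
have [n n1 yn] := e_onto (subsetP (imgG_sub hg) y hy).
have hn : n \in hs by rewrite -mem_imgG // yn.
by rewrite -yn -xm conjgE mulgA -eV // -!eM ?det1M // mem_imgG ?det1M // (allP nm).
Qed.

Local Open Scope group_scope.

Lemma Sylow_conj (p : nat) (S : {group gT}) hs : groupb hs -> size hs = (504`_p)%N ->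
  S \in 'Syl_p(G) -> exists2 x, x \in G & S :=: (imgG hs :^ x)%G.
Proof.
move=> hg sz; rewrite inE => sylS.
have sylH : p.-Sylow(G) (imgG hs).
  by rewrite pHallE imgG_sub //= card_imgG // sz oG eqxx.
by have [x Gx ->] := Sylow_trans sylH sylS; exists x.
Qed.

Lemma part_504 : ((504`_2 = 8)%N * (504`_3 = 9)%N * (504`_7 = 7)%N)%type.
Proof. by rewrite !p_part. Qed.

Lemma C9_conj (C : {group gT}) : C \subset G -> #|C| = 9%N ->
  exists2 x, x \in G & C :=: (imgG hC9 :^ x)%G.
Proof.
move=> sCG oC; apply: (@Sylow_conj 3 C hC9); rewrite ?part_504 ?groupb_C9 //.
by rewrite inE pHallE sCG oC oG part_504 eqxx.
Qed.

(** By Sylow's theorem [C] lies in a conjugate of the cyclic group [C'], and a cyclic group has only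
    one subgroup of order 3. *)
Lemma C3_conj (C C' : {group gT}) : C' \subset G -> cyclic C' -> #|C'| = 9%N ->
  C \subset G -> #|C| = 3%N -> exists2 x, x \in G & C :=: (imgG hC3 :^ x)%G.
Proof.
move=> sC'G cycC' oC' sCG oC.
have sylC' : 3.-Sylow(G) C' by rewrite pHallE sC'G oC' oG part_504 eqxx.
have pC : 3.-group C by rewrite /pgroup oC.
have [x Gx sCx] := Sylow_subJ sylC' sCG pC.
have [y Gy C'E] := C9_conj sC'G oC'.
exists (y * x); rewrite ?groupM //; apply/eqP.
have cyc : cyclic (C' :^ x) by rewrite cyclicJ.
rewrite (eq_subG_cyclic cyc) // ?cardJg ?oC ?card_imgG ?groupb_C3 //.
rewrite /= conjsgM conjSg C'E conjSg imgG_subset ?groupb_C3 ?groupb_C9 //.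
by apply/allP; vm_compute.
Qed.

(** A Sylow p-subgroup [Q] of [D] has index 2, so [D] normalizes it. [Q] is also a Sylow subgroup of
    the whole group, and its normalizer there has the order of [D], hence equals [D]. *)
Lemma dihedral_conj (p : nat) (D : {group gT}) hs hs' :
  groupb hs -> groupb hs' -> size hs = (504`_p)%N ->
  size hs' = (2 * size hs)%N -> size hs = ((size hs')`_p)%N ->
  all (fun m => normb hs m == (m \in hs')) sl2_elts ->
  D \subset G -> #|D| = size hs' -> exists2 x, x \in G & D :=: (imgG hs' :^ x)%G.
Proof.
move=> hg hg' sz sz' szp hN sDG oD; have [Q sylQ] := Sylow_exists p D.
have oQ : #|Q| = size hs by rewrite (card_Hall sylQ) oD -szp.
have sQD := pHall_sub sylQ.
have nQD : Q <| D.
  apply: index2_normal => //; apply/eqP; rewrite -(eqn_pmul2l (cardG_gt0 Q)) Lagrange //.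
  by rewrite oQ oD sz' mulnC.
have [x Gx QE] : exists2 x, x \in G & Q :=: (imgG hs :^ x)%G.
  apply: (Sylow_conj hg sz); rewrite inE pHallE (subset_trans sQD sDG).
  by rewrite oQ oG sz eqxx.
exists x => //; apply/eqP; rewrite eqEcard cardJg card_imgG // oD leqnn andbT.
rewrite /= -(normalizer_imgG hg hg' hN) conjIg -normJ conjGid // subsetI sDG.
by move: QE => /= <-; case/andP: nQD.
Qed.

Lemma D7_conj (D : {group gT}) : D \subset G -> #|D| = 14%N ->
  exists2 x, x \in G & D :=: (imgG hD7 :^ x)%G.
Proof.
move=> sDG oD; apply: (@dihedral_conj 7 D hC7 hD7); rewrite ?groupb_C7 ?groupb_D7 ?part_504 ?normb_C7 //.
by rewrite p_part.
Qed.

Lemma D9_conj (D : {group gT}) : D \subset G -> #|D| = 18%N ->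
  exists2 x, x \in G & D :=: (imgG hD9 :^ x)%G.
Proof.
move=> sDG oD; apply: (@dihedral_conj 3 D hC9 hD9); rewrite ?groupb_C9 ?groupb_D9 ?part_504 ?normb_C9 //.
by rewrite p_part.
Qed.

Lemma Borel_conj (S : {group gT}) : S \in 'Syl_2(G) ->
  exists2 x, x \in G & 'N_G(S)%G :=: (imgG hB :^ x)%G.
Proof.
move=> sylS; have [x Gx SE] : exists2 x, x \in G & S :=: (imgG hS :^ x)%G.
  by apply: (Sylow_conj (p := 2)) sylS; rewrite ?groupb_S ?part_504.
by exists x; rewrite //= -(normalizer_imgG groupb_S groupb_B normb_S) conjIg -normJ conjGid // SE.
Qed.
End Model.

(** * Coordinates *)

(* Vectors of [Z[G/C3] + Z[G/C9] + Z[G/D7]]. *)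
Definition vec3 := (seq Z * seq Z * seq Z)%type.
Definition sl2_letter i := nth sl2_one [:: cC; sl2_inv cC; cD; sl2_inv cD; cT] i.
(* Hamiltonian paths from the trivial coset in the graph of left
   multiplications by [sl2_letter i], [i < 4], on the cosets of the subgroup. *)
Definition walk_C3 : seq nat := [:: 3; 1; 3; 1; 1; 1; 1; 3; 0; 0; 2; 0; 3; 1; 1; 3; 0; 0; 3; 3; 0;
  0; 3; 3; 1; 1; 2; 2; 2; 0; 2; 2; 0; 3; 0; 0; 0; 2; 2; 0; 3; 0; 0; 0; 0; 0; 3; 0; 2; 2; 1; 1; 2; 1;
  3; 1; 2; 2; 1; 3; 0; 0; 2; 0; 2; 0; 0; 3; 3; 0; 3; 0; 0; 0; 3; 0; 0; 2; 1; 2; 0; 0; 2; 2; 0; 2; 1;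
  1; 2; 1; 1; 2; 1; 2; 1; 1; 1; 2; 2; 0; 3; 3; 0; 0; 2; 2; 1; 2; 1; 1; 1; 3; 3; 3; 0; 0; 3; 3; 0; 0;
  2; 1; 2; 0; 0; 0; 0; 2; 1; 2; 0; 0; 2; 1; 2; 1; 1; 2; 2; 2; 2; 2; 1; 2; 1; 2; 2; 1; 2; 0; 0; 2; 1;
  3; 1; 1; 1; 3; 1; 2; 2; 2; 2; 2; 1; 2; 1].
Definition walk_C9 : seq nat := [:: 2; 0; 3; 0; 0; 0; 3; 0; 3; 1; 3; 0; 3; 3; 1; 3; 3; 1; 1; 3; 3;
  3; 3; 1; 2; 1; 2; 1; 3; 0; 2; 0; 0; 3; 0; 2; 2; 1; 2; 2; 0; 2; 1; 3; 3; 3; 0; 0; 2; 1; 1; 2; 0; 0;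
  3].
Definition walk_D7 : seq nat := [:: 0; 3; 3; 0; 0; 2; 0; 3; 3; 0; 3; 3; 1; 3; 0; 0; 3; 0; 2; 1; 3;
  3; 1; 3; 1; 1; 3; 3; 3; 0; 3; 1; 3; 3; 0].
Definition walk_D9 : seq nat := [:: 2; 2; 2; 1; 2; 2; 2; 1; 3; 1; 1; 1; 2; 0; 0; 3; 3; 1; 3; 3; 0;
  3; 0; 3; 0; 2; 1].
Definition walk_C7 : seq nat := [:: 0; 3; 3; 0; 0; 3; 1; 2; 0; 3; 0; 2; 0; 2; 0; 0; 0; 2; 1; 3; 3;
  1; 2; 0; 0; 3; 0; 0; 0; 3; 3; 3; 3; 3; 3; 0; 3; 1; 3; 3; 1; 1; 3; 1; 3; 0; 0; 2; 1; 1; 2; 1; 3; 0;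
  3; 3; 1; 3; 0; 0; 2; 1; 3; 0; 3; 3; 0; 0; 2; 2; 1].

Local Open Scope Z_scope.

(* The images of the base vectors; [w_C3] and [w_D9] were chosen so that they
   span a locally split sublattice, and [w_C7] by lattice reduction so that the
   determinants of all isotypic components are units. *)
Definition w_C3 : vec3 := ([:: 0; 0; 0; 1; 0; 0; 1; 0; 0; 0; 0; 0; 0; 0; 0; 0; 0; 0; 0; 0; -1; 0; 0;
  0; 0; 0; 0; 0; 0; 0; 0; 0; 0; 0; 0; 0; 0; 0; 0; 0; 0; 0; 0; 0; 0; 0; 0; 0; 0; 0; 0; 0; 0; 0; 0; 0;
  0; 0; 0; 0; 0; 0; 0; 0; 0; 0; 0; 0; 0; 0; 0; 0; 0; 0; 0; 0; 0; -1; 0; 0; 0; 0; 0; 0; 0; 0; 0; 0;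
  0; 0; 0; 0; 0; 0; -1; 0; 0; -1; 0; 0; 0; 0; 0; 0; 0; 0; 0; 0; 0; 0; 0; 0; 0; 0; 0; 0; 0; 0; 0; 0;
  0; 0; 0; 0; 0; 0; 0; 0; 0; 0; 0; 0; 0; 0; 0; 0; 0; 0; 0; 0; 0; 0; 0; 0; 0; 0; 0; 0; 0; 0; 1; 0; 0;
  0; 0; 0; 0; 0; 0; 0; 0; 0; 0; 0; 0; 0; 0; 0],  [:: -1; 0; 0; 0; 1; 0; 0; 0; 0; 0; 0; 1; 0; 1; 0;
  0; 0; 1; 0; 0; 0; 0; 0; 0; 0; 0; 0; 1; 0; 0; 0; 0; 0; 1; 0; 0; 0; 0; 0; 0; 0; 0; 0; 0; 0; 1; 0; 1;
  0; 1; 0; 0; 0; 0; 0; 0],  [:: 0; 0; 0; -1; 0; 0; 0; 1; 1; 0; 0; 0; -1; 0; 0; 0; 0; 0; 0; 0; 0; 0;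
  0; 0; 0; 0; 1; 1; 1; 0; 0; 0; 0; 1; -1; 0]).
Definition w_D9 : vec3 := ([:: 0; 0; 0; 0; 0; 0; 0; 0; 0; 0; 0; 0; 0; -1; -1; -1; 0; 0; 0; 0; -1;
  -1; -1; 1; 0; 0; 0; 0; 0; 0; 0; 0; 0; 0; 0; 0; 0; 0; 0; 0; 0; 0; 0; 0; 0; 0; 0; 0; 0; 0; 0; 0; 0;
  0; 0; 0; 0; 0; 0; 0; 0; 0; 0; 0; 0; 0; 0; 0; 1; 0; 0; 1; 1; 1; 1; 0; 0; 0; 0; 0; 0; 0; 0; -1; 1;
  1; -1; -1; -1; 0; 0; 0; 0; 0; -1; -1; -1; -1; -1; 0; 0; 0; 0; 0; 0; 0; 0; 0; 0; 0; 0; 0; 0; 0; 0;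
  0; 0; 0; 0; 0; 0; 0; 0; 0; 0; 0; 0; 0; 0; 0; 1; 1; 1; 0; 0; 0; 0; 0; -1; 1; 0; 0; 0; 0; 0; 0; 0;
  0; 0; 0; 0; 0; 1; 1; 0; 0; 0; 0; 1; 1; 0; -1; -1; 0; 1; 1; 0; 0],  [:: 1; 0; 0; -1; -1; -1; -1; 0;
  0; 0; 0; -1; -1; -1; 0; 0; -1; 0; 0; 0; 1; 0; 0; 0; 0; 0; 0; 0; 0; 0; 0; -1; -1; -1; -1; -1; 0; 0;
  0; 0; 0; 0; 0; 0; 0; -1; -1; -1; -1; 0; 0; 0; 0; 0; 0; -1],  [:: 0; 0; 0; 1; 1; 1; 0; 0; 0; 0; 0;
  0; 1; 1; 0; 0; 0; 0; 0; 0; 0; 0; 0; 0; 0; 0; 0; 0; 0; 1; 1; 0; 0; 0; 1; 1]).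
Definition w_C7 : vec3 := ([:: 0; 0; 0; 0; 0; -1; -1; 0; 0; 0; 0; 0; 0; 0; 3; 1; 1; -1; 2; 2; 2; 2;
  0; 0; 0; 0; 1; 1; 1; 1; 0; 0; 0; -1; -1; 0; -1; 1; 1; 1; 0; 0; 0; 0; -1; 2; 1; 1; 0; 0; 0; -1; 0;
  0; -1; -1; 1; 1; 1; 0; 0; -1; 0; 0; -1; -1; -1; -1; -1; -1; 2; 2; 0; 3; -1; -1; -1; -3; -3; 1; 1;
  1; -1; -1; -1; 0; 0; -2; -2; -2; -1; -1; -1; -1; -1; 0; 0; 3; 3; 3; 0; 0; 0; 3; 1; 1; 1; 0; 0; 0;
  0; 1; 1; 1; 1; -1; 0; 0; 0; 0; -2; -2; 1; 1; 0; 1; 1; 0; 0; -1; -1; 3; 0; 0; 0; 0; -3; 1; 1; 1; 1;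
  1; 1; -3; -3; -1; -1; -1; 0; 0; -1; -3; -3; -2; -2; 1; 0; 0; 0; 0; 0; 0; 0; 0; 0; 0; 0; 0],  [::
  -1; -1; -3; -3; 2; 2; -3; -3; -1; -1; 0; 0; 1; 1; 1; 1; 1; 1; 1; 1; 1; 1; 1; 1; 0; 0; -1; -1; 1;
  1; 1; 1; 0; 0; 0; 0; 0; 0; -3; -3; -3; 1; 1; 0; 0; 0; 0; 2; 1; 1; -1; 2; 2; 1; 2; 2],  [:: 3; 1;
  1; 1; -1; -2; -2; -2; -2; -2; 1; 1; 1; -1; -1; 0; -1; -1; 1; 1; 0; 0; 0; -1; -1; -2; 1; 1; 1; 1;
  1; 1; 0; 0; 0; -2]).
(* Preimages of the base vectors of the three summands, in coordinates indexed
   by [rs_C3], [rs_D9] and [rs_C7]. *)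
Definition pre_C3 : vec3 := ([:: -209; 146; 121; 2; 26; -137; 2; 26; -28; -28; 143; 34; -66; -64;
  -207; 182; -149; -14; -30; 36; -17; 148; -202; 32; -189; 146; 121; -30; 36; 25; -22; 139; 9; 95;
  -10; 142; 34; -10; -189; -17; -58; 2; 119; 76; 2; 119; 76; -189; 9; 139; -167; -52; -18; 34; -166;
  119; 2; 34; 8; -147; -28; -28; 143; -14; -30; 121; 146; -189; 32; -66; -166; 128; -26; 132; 128;
  -433; 20; 46; 8; -147; -28; -28; 143; -207; -26; 132; -207; 182; -64; 59; 80; 35; 25; 36; -17;
  -202; 148; -17; 148; -96; 50; 142; -18; -52; -167; 139; -22; 25; 35; 59; 80; 35; 59; -8; 9; 95;
  -189; 76; -18; -52; -167; 163; -58; 163; -17; -58; 163; -17; 34; -166; 128; -26; 132; -189; 95;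
  -10; 34; 142; -202; 112; -137; 80; -14; -149; 8; -147; -22; 50; -96; 26; 2; -137; 112; 70; -8; 50;
  -96; -8; 70; 32; -66; -64; 182; -149; 112; 70; -359; 211], [:: -38; -247; 96; 150; -130; 5; 150;
  96; -11; 5; 177; -57; 5; -130; 150; -247; 12; -130; -247; 96; -57; 177; -57; 177; 12; -11; -11;
  12], [:: -88; -111; -102; 10; 87; -23; 6; -96; 2; 102; -3; 6; -60; -33; -38; 107; 24; 37; -36;
  -82; 65; 49; 5; -33; -75; 6; 73; 42; 131; -40; 47; 38; 52; -194; -124; 56; 135; -80; -76; -70; 11;
  10; 127; 91; -41; -42; -26; 77; 95; 81; 141; -33; -17; -87; -5; 33; 6; 47; -70; -11; -92; 9; -56;
  -84; 0; 0; 0; 0; 0; 0; 0; 0]).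
Definition pre_C9 : vec3 := ([:: 76; -3; -3; 13; 13; 13; 13; 13; -3; -3; -3; 26; 26; 2; 2; 2; 13;
  13; 13; -18; 13; 13; 13; 14; -3; -3; -3; 13; -18; -18; -18; 22; 1; 1; -27; -27; -27; -27; -3; -38;
  -38; -38; -38; -38; -38; -38; -38; 1; 1; 22; 34; 34; 34; 26; 26; -38; -38; -27; 22; 22; -3; -3;
  -3; 13; 13; -3; -3; -3; 14; 26; 26; 0; 0; 0; 0; 62; 62; 62; 22; 22; -3; -3; -3; 2; 0; 0; 2; 2; 2;
  -35; -35; -35; -18; -18; 13; 13; 13; 13; 13; -22; -22; -27; 34; 34; 34; 22; -18; -18; -35; -35;
  -35; -35; -35; -22; 1; 1; 1; -38; 34; 34; 34; -38; -38; -38; -38; -38; -38; -38; 26; 26; 0; 0; 0;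
  1; 1; -27; -27; -27; 13; 14; 13; -35; 13; 13; 22; 22; -18; -22; -22; 13; 13; 13; 14; 14; -22; -22;
  -22; -22; 14; 14; 26; 2; 2; 13; 14; 14; 76; 76], [:: 113; 49; -5; 49; 49; -57; 49; -5; -5; -57;
  -57; -57; -57; 49; 49; 49; -5; 49; 49; -5; -57; -57; -57; -57; -5; -5; -5; -5], [:: 10; 34; 34; 9;
  -18; 5; 34; -1; -22; -18; 7; -12; -1; 36; 32; 0; 14; 21; -10; 32; -4; 11; 7; 34; 32; 22; -2; -35;
  -13; -10; -28; -10; -26; 8; 10; -26; -38; -9; 14; 0; -4; -2; -38; -12; 22; 8; -26; -2; -13; -9;
  -4; -4; 21; 25; -2; 11; -35; -28; 25; -26; -15; -18; 9; -15; 0; 0; 0; 0; 0; 0; 0; 0]).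
Definition pre_D7 : vec3 := ([:: 27; 27; -119; -119; -6; 30; 68; -25; -25; 27; 1; 1; -25; -25; 42;
  -41; -41; 67; -74; -74; -74; -74; 67; 67; 67; 27; 30; 30; 30; 30; -119; -119; -119; -6; -6; 67;
  30; 30; 30; 30; -25; -25; -25; -119; 30; -74; 30; 30; 68; 68; 68; -41; 67; 67; 30; 30; -41; -41;
  -41; -6; -6; -41; -119; -119; 68; 68; -41; -6; -6; -6; -74; -74; -6; 42; 68; 68; -6; 27; 27; 30;
  30; 30; 67; 67; 67; 1; 1; -74; -74; -74; 30; -41; -41; -41; -41; 42; -25; 42; 42; 42; -119; -119;
  -119; 42; 30; 30; 30; -25; -25; -25; -119; 30; 30; 30; 30; -6; 1; 1; 1; 27; -74; -74; 30; 30; 67;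
  -41; -41; -119; -119; 68; 68; 42; 27; 27; -25; -25; 27; 1; 1; 1; 1; 1; 1; 27; 27; 67; 67; 67; -6;
  -6; 30; 27; 27; -74; -74; 1; -25; 68; 68; 42; 42; 42; 42; 42; 42; 68; 68; -6], [:: 102; 102; 102;
  102; -82; -82; -82; -82; 7; 7; -28; -28; 7; 7; 7; 102; 102; 102; -28; -28; -28; -82; -82; -28;
  -28; 7; 7; -82], [:: 76; -15; -15; 20; 40; -10; -35; -30; -15; 5; -30; 5; 40; 0; 40; -42; -27;
  -15; -35; -30; 40; 55; -30; 20; 20; 76; -7; -7; -42; -27; -22; -27; -42; -15; -15; -30; 5; 20; 0;
  -15; 10; 0; -7; -7; 20; 5; -10; 40; -42; -27; -22; 55; -15; 0; 20; 5; 40; 10; 20; -30; 20; 5; 5;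
  5; 0; 0; 0; 0; 0; 0; 0; 0]).
Local Close Scope Z_scope.

Definition walk_elts ws := sl2_one :: scanl (fun m i => sl2_mul (sl2_letter i) m) sl2_one ws.
Definition rs_C3 := Eval vm_compute in walk_elts walk_C3.
Definition rs_C9 := Eval vm_compute in walk_elts walk_C9.
Definition rs_D7 := Eval vm_compute in walk_elts walk_D7.
Definition rs_D9 := Eval vm_compute in walk_elts walk_D9.
Definition rs_C7w := Eval vm_compute in walk_elts walk_C7.
(** A matrix stands for its image of infinity: [cT] exchanges infinity and 0, and [cU x] moves 0 to
    x. Infinity comes first, as the base coset. *)
Definition points := Eval vm_compute in sl2_one :: [seq sl2_mul (cU x) cT | x <- f8_elts].

(* [hB] is the stabilizer of the point at infinity: [m] and [p] send that point
   to the same point. *)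
Definition at_pt m p := sl2_mul (sl2_inv p) m \in hB.
(* The coset of [m] corresponds to the pair of images by [m] of the points at
   infinity and [0]; the pairs [(p, last)] come last, in the order of [points],
   since they form the basis of a complement used to define the quotient. *)
Definition order_C7 := Eval vm_compute in
  let last := nth sl2_one points 8 in
  [seq k <- iota 0 72 | ~~ at_pt (sl2_mul (nth sl2_one rs_C7w k) cT) last] ++
  [seq find (fun m => at_pt m p && at_pt (sl2_mul m cT) last) rs_C7w | p <- take 8 points].
Definition rs_C7 := Eval vm_compute in [seq nth sl2_one rs_C7w k | k <- order_C7].

(* Row [i] sends the index of a coset to that of its image by the inverse of
   [sl2_letter i], so that [actz] below is a mere lookup. *)
Definition table (hs rs : seq sl2) :=
  [seq [seq find (fun x => sl2_mul (sl2_inv x) (sl2_mul (sl2_inv (sl2_letter i)) r) \in hs) rs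
         | r <- rs] | i <- iota 0 5].
Definition tab_C3 := Eval vm_compute in table hC3 rs_C3.
Definition tab_C9 := Eval vm_compute in table hC9 rs_C9.
Definition tab_D7 := Eval vm_compute in table hD7 rs_D7.

Definition transversalb (hs rs : seq sl2) :=
  [&& all is_sl2 rs, pairwise (fun x y => sl2_mul (sl2_inv x) y \notin hs) rs
    & size rs * size hs == 504]%N.
Definition tableb (hs rs : seq sl2) (tb : seq (seq nat)) :=
  all (fun i => all (fun k =>
      let j := nth 0 (nth [::] tb i) k in
      [&& (j < size rs)%N, (k < size (nth [::] tb i))%N &
        sl2_mul (sl2_inv (nth sl2_one rs j)) (sl2_mul (sl2_inv (sl2_letter i)) (nth sl2_one rs k)) \in hs])
    (iota 0 (size rs))) (iota 0 5).

Lemma trans_C3 : transversalb hC3 rs_C3. Proof. by vm_compute. Qed.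
Lemma trans_C9 : transversalb hC9 rs_C9. Proof. by vm_compute. Qed.
Lemma trans_D7 : transversalb hD7 rs_D7. Proof. by vm_compute. Qed.
Lemma trans_D9 : transversalb hD9 rs_D9. Proof. by vm_compute. Qed.
Lemma trans_C7 : transversalb hC7 rs_C7. Proof. by vm_compute. Qed.
Lemma trans_B : transversalb hB points. Proof. by vm_compute. Qed.
Lemma table_C3 : tableb hC3 rs_C3 tab_C3. Proof. by vm_compute. Qed.
Lemma table_C9 : tableb hC9 rs_C9 tab_C9. Proof. by vm_compute. Qed.
Lemma table_D7 : tableb hD7 rs_D7 tab_D7. Proof. by vm_compute. Qed.

(** * Vectors as lists of binary integers, and the numerical certificates *)

Definition actz (tb : seq nat) (v : seq Z) := [seq nth Z0 v j | j <- tb].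
Definition act3 i (v : vec3) : vec3 :=
  let: (x, y, z) := v in
  (actz (nth [::] tab_C3 i) x, actz (nth [::] tab_C9 i) y, actz (nth [::] tab_D7 i) z).
(** Follows the walk of [walk_elts], so that entry k is the translate of [v] by representative k, at
    the price of one lookup per coordinate and step. *)
Definition orbit3 ws v := v :: scanl (fun x i => act3 i x) v ws.

(** Missing entries count as zeros, so the empty list is neutral. *)
Fixpoint addz (s t : seq Z) :=
  match s, t with
  | x :: s', y :: t' => Z.add x y :: addz s' t'
  | [::], _ => t
  | _, [::] => s
  end.
Definition zero3 : vec3 := ([::], [::], [::]).
Definition add3 (v w : vec3) : vec3 :=
  let: (x, y, z) := v in let: (x', y', z') := w in (addz x x', addz y y', addz z z').
Definition scale3 (a : Z) (v : vec3) : vec3 :=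
  let: (x, y, z) := v in (map (Z.mul a) x, map (Z.mul a) y, map (Z.mul a) z).
Definition lin3 (ns : seq Z) (vs : seq vec3) :=
  foldr (fun p acc => add3 (scale3 p.1 p.2) acc) zero3 (zip ns vs).

Definition reorder (vs : seq vec3) := [seq nth zero3 vs k | k <- order_C7].

(** The length is n + 1: ranks 168, 56 and 36 appear as 167, 55 and 35. *)
Definition unitz n : seq Z := Z.one :: nseq n Z0.
Definition zeroz n : seq Z := nseq n Z0.

Definition combine xs3 xs9 xs7 (u : vec3) :=
  add3 (add3 (lin3 u.1.1 xs3) (lin3 u.1.2 xs9)) (lin3 u.2 xs7).

Lemma combineE :
  [seq combine (orbit3 walk_C3 w_C3) (orbit3 walk_D9 w_D9) (reorder (orbit3 walk_C7 w_C7)) u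
    | u <- [:: pre_C3; pre_C9; pre_D7]] =
  [:: (unitz 167, zeroz 56, zeroz 36); (zeroz 168, unitz 55, zeroz 36);
      (zeroz 168, zeroz 56, unitz 35)].
Proof. by vm_compute. Qed.

(* The coefficient of [p] in [x - y], where [(x, y)] is the pair of the coset of
   [m]. *)
Definition boundary m p : Z :=
  Z.sub (if at_pt m p then Z.one else Z0) (if at_pt (sl2_mul m cT) p then Z.one else Z0).

(** Annihilation is tested at the point at infinity only; transitivity on the points gives the
    others in [T7_kill]. *)
Lemma kill_check : lin3 [seq boundary m sl2_one | m <- rs_C7] (reorder (orbit3 walk_C7 w_C7)) =
  (zeroz 168, zeroz 56, zeroz 36).
Proof. by vm_compute. Qed.

(** The pair in place 64 + j consists of point j and the last point, so its difference is the j-th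
    basis vector of the augmentation lattice. *)
Lemma split_check : all (fun i => all (fun j =>
    boundary (nth sl2_one rs_C7 (64 + j)) (nth sl2_one points i) == if i == j then Z.one else Z0)
  (iota 0 8)) (iota 0 8).
Proof. by vm_compute. Qed.

Lemma fix_C3 : act3 0 (act3 0 (act3 0 w_C3)) = w_C3. Proof. by vm_compute. Qed.
Lemma fix_D9 : act3 0 w_D9 = w_D9. Proof. by vm_compute. Qed.
Lemma fix_D9' : act3 4 w_D9 = w_D9. Proof. by vm_compute. Qed.
Lemma fix_C7 : act3 2 w_C7 = w_C7. Proof. by vm_compute. Qed.

(** * From lists of integers to vectors of lattices *)

Section Coordinates.
Variables (gT : finGroupType) (G : {group gT}) (e : sl2 -> gT).
Hypothesis eM : forall m n, sl2_det m = f8_1 -> sl2_det n = f8_1 ->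
  e (sl2_mul m n) = (e m * e n)%g.
Hypothesis e_inj : forall m n, sl2_det m = f8_1 -> sl2_det n = f8_1 -> e m = e n -> m = n.
Hypothesis eG : forall m, sl2_det m = f8_1 -> e m \in G.
Hypothesis e_onto : forall y, y \in G -> exists2 m, sl2_det m = f8_1 & e m = y.
Hypothesis det1M : forall m n, sl2_det m = f8_1 -> sl2_det n = f8_1 ->
  sl2_det (sl2_mul m n) = f8_1.

Definition cosets hs rs n (j : 'I_n) : {set gT} := lcoset (imgG e hs) (e (nth sl2_one rs j)).
Arguments cosets : clear implicits.

Lemma det_nth rs k : all is_sl2 rs -> sl2_det (nth sl2_one rs k) = f8_1.
Proof.
move=> /allP rs1; have [lt_k | ge_k] := ltnP k (size rs); last by rewrite nth_default.
exact/eqP/rs1/mem_nth.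
Qed.

Lemma lcoset_img hs m n : groupb hs -> sl2_det m = f8_1 -> sl2_det n = f8_1 ->
  (lcoset (imgG e hs) (e m) == lcoset (imgG e hs) (e n)) = (sl2_mul (sl2_inv n) m \in hs).
Proof.
move=> hg m1 n1; rewrite !lcosetE; apply/eqP/idP => [eq_mn | h].
  have : e m \in (e n *: imgG e hs)%g by rewrite -eq_mn lcoset_refl.
  by rewrite mem_lcoset -(eV eM) // -eM ?det1V // mem_imgG ?det1M ?det1V.
apply/lcoset_eqP; rewrite mem_lcoset -(eV eM) // -eM ?det1V //.
by rewrite mem_imgG ?det1M ?det1V.
Qed.

Section Basis.
Variables (hs rs : seq sl2) (n : nat).
Hypotheses (hg : groupb hs) (tr : transversalb hs rs) (sz : size rs = n).
Let H := imgG e hs.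
Let b := cosets hs rs n.
Let rs1 : all is_sl2 rs. Proof. by case/and3P: tr. Qed.

Lemma cosets_inj : injective b.
Proof.
case/and3P: tr => _ /(pairwiseP sl2_one) pw _.
have lt_neq (i j : 'I_n) : (i < j)%N -> b i <> b j.
  move=> lt_ij /esym/eqP; rewrite lcoset_img ?det_nth //.
  by apply/negP/pw => //; rewrite inE sz.
move=> i j bij; apply: val_inj; case: (ltngtP i j) => // /lt_neq; first by [].
by move/(_ (esym bij)).
Qed.

Lemma cosets_rep j : exists2 y, y \in G & b j = lcoset H y.
Proof. by exists (e (nth sl2_one rs j)); rewrite ?eG ?det_nth. Qed.

(** By counting: the listed cosets are distinct, and their number times the order of the subgroup is
    504. *)
Lemma cosets_onto y : y \in G -> exists j, b j = lcoset H y.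
Proof.
move=> Gy; have sHG : H \subset G by apply: imgG_sub.
have : lcoset H y \in lcosets H G by apply/lcosetsP; exists y; rewrite ?lcosetE.
suff <- : b @: setT = lcosets H G by case/imsetP=> j _ ->; exists j.
apply/eqP; rewrite eqEcard; apply/andP; split.
  apply/subsetP=> _ /imsetP[j _ ->]; apply/lcosetsP.
  by have [z Gz ->] := cosets_rep j; exists z; rewrite ?lcosetE.
rewrite card_imset; last exact: cosets_inj.
rewrite cardsT card_ord -(leq_pmul2l (cardG_gt0 H)) card_lcosets Lagrange //.
rewrite (card_imgG eM e_inj hg) (oG e_inj eG e_onto) mulnC -sz.
by case/and3P: tr => _ _ /eqP->.
Qed.

Lemma cosets_basis : set_basis G b.
Proof.
split=> [|g j Gg]; first exact: cosets_inj.
have [y Gy bj] := cosets_rep j; have [i bi] := cosets_onto (groupM Gg Gy).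
by exists i; rewrite bi bj !lcosetE mulgA mulg_set1.
Qed.

Lemma cosets_iso x : x \in G -> sum_iso G (set_lat b) (perm_lat G (H :^ x)%G).
Proof.
move=> Gx; apply: set_lat_perm_iso => //.
- exact: imgG_sub.
- exact: cosets_inj.
- exact: cosets_rep.
exact: cosets_onto.
Qed.
End Basis.

(** The evaluations run in binary [Z], while the lattices are over [int]; [int_of_Z] is a ring
    morphism between the two. *)
Definition zcol n (v : seq Z) : 'cV[int]_n := \col_i int_of_Z (nth Z0 v i).

Lemma letter_det i : sl2_det (sl2_letter i) = f8_1.
Proof. by case: i => [|[|[|[|[|i]]]]] //; rewrite /sl2_letter nth_default. Qed.

(** Row k of the permutation matrix of g has its only 1 in the column of the coset moved to k by g,
    which is the entry stored in the table. *)
Lemma act_zcol hs rs n tb i v : groupb hs -> transversalb hs rs -> size rs = n ->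
  tableb hs rs tb -> (i < 5)%N ->
  rep (set_lat (cosets hs rs n)) (e (sl2_letter i)) *m zcol n v = zcol n (actz (nth [::] tb i) v).
Proof.
move=> hg tr sz /allP tbl i5; have inj_b := cosets_inj hg tr sz.
have rs1 : all is_sl2 rs by case/and3P: tr.
have li := letter_det i.
apply/matrixP=> k c; rewrite ord1 {c} !mxE.
have ki : (k : nat) \in iota 0 (size rs) by rewrite mem_iota sz /=.
have ii : i \in iota 0 5 by rewrite mem_iota.
have /and3P[lt_j lt_k in_hs] := allP (tbl i ii) k ki.
set j := nth 0%N _ k in lt_j in_hs; rewrite sz in lt_j.
have bj : lcoset (cosets hs rs n (Ordinal lt_j)) (e (sl2_letter i)) = cosets hs rs n k.
  have : lcoset (imgG e hs) (e (sl2_mul (sl2_inv (sl2_letter i)) (nth sl2_one rs k))) =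
         cosets hs rs n (Ordinal lt_j).
    have rk1 := det_nth k rs1; have rj1 := det_nth (nth 0%N (nth [::] tb i) k) rs1.
    apply/eqP; rewrite /cosets lcoset_img ?det_nth //.
    by apply: det1M; rewrite ?det1V.
  rewrite eM ?det1V ?det_nth // (eV eM) // => <-.
  by rewrite /cosets !lcosetE mulgA mulg_set1 mulKVg.
rewrite (bigD1 (Ordinal lt_j)) //= big1 ?addr0 => [|l /negPf ne_l]; rewrite !mxE -bj.
  by rewrite eqxx mul1r (nth_map 0%N).
by rewrite !lcosetE (inj_eq (@lcoset_inj _ _)) eq_sym (inj_eq inj_b) ne_l mul0r.
Qed.

Notation b_C3 := (cosets hC3 rs_C3 168).
Notation b_C9 := (cosets hC9 rs_C9 56).
Notation b_D7 := (cosets hD7 rs_D7 36).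
Notation b_D9 := (cosets hD9 rs_D9 28).
(** The sums 64 + 8 and 8 + 1 stay unreduced to match the block decompositions of the resolution. *)
Notation b_C7 := (cosets hC7 rs_C7 (64 + 8)).
Notation b_B := (cosets hB points (8 + 1)).
Notation Q := (dsum (dsum (set_lat b_C3) (set_lat b_C9)) (set_lat b_D7)).

Lemma basis_C3 : set_basis G b_C3. Proof. exact: cosets_basis groupb_C3 trans_C3 (erefl _). Qed.
Lemma basis_C9 : set_basis G b_C9. Proof. exact: cosets_basis groupb_C9 trans_C9 (erefl _). Qed.
Lemma basis_D7 : set_basis G b_D7. Proof. exact: cosets_basis groupb_D7 trans_D7 (erefl _). Qed.
Lemma basis_C7 : set_basis G b_C7. Proof. exact: cosets_basis groupb_C7 trans_C7 (erefl _). Qed.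
Lemma basis_B : set_basis G b_B. Proof. exact: cosets_basis groupb_B trans_B (erefl _). Qed.

Lemma glat_Q : is_glat G Q.
Proof.
by do 2?apply: is_glat_dsum; apply: is_glat_set_lat; [exact: basis_C3 | exact: basis_C9 | exact: basis_D7].
Qed.

Definition qcol (v : vec3) : 'cV[int]_(168 + 56 + 36) :=
  let: (x, y, z) := v in col_mx (col_mx (zcol 168 x) (zcol 56 y)) (zcol 36 z).

Lemma qcolE x y z : qcol (x, y, z) = col_mx (col_mx (zcol 168 x) (zcol 56 y)) (zcol 36 z).
Proof. by []. Qed.

Lemma act3_qcol i v : (i < 5)%N -> rep Q (e (sl2_letter i)) *m qcol v = qcol (act3 i v).
Proof.
case: v => [[x y] z] i5 /=; rewrite !mul_block_col !mul0mx !addr0 !add0r.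
rewrite (act_zcol x groupb_C3 trans_C3 _ table_C3) //.
rewrite (act_zcol y groupb_C9 trans_C9 _ table_C9) //.
by rewrite (act_zcol z groupb_D7 trans_D7 _ table_D7).
Qed.

Lemma rep_e_mul m n (w : 'cV_(rk Q)) : sl2_det m = f8_1 -> sl2_det n = f8_1 ->
  rep Q (e (sl2_mul m n)) *m w = rep Q (e m) *m (rep Q (e n) *m w).
Proof. by move=> m1 n1; rewrite eM // (proj2 glat_Q) ?eG // mulmxA. Qed.

Lemma orbit3_walk_from ws m v (w : 'cV_(rk Q)) k : sl2_det m = f8_1 -> qcol v = rep Q (e m) *m w ->
  all (ltn^~ 5) ws -> (k <= size ws)%N ->
  qcol (nth zero3 (v :: scanl (fun x i => act3 i x) v ws) k) =
  rep Q (e (nth sl2_one (m :: scanl (fun n i => sl2_mul (sl2_letter i) n) m ws) k)) *m w.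
Proof.
elim: ws m v k => [|i ws IHws] m v [|k] //= m1 vE /andP[i5 ws5] lt_k.
apply: (IHws (sl2_mul (sl2_letter i) m) (act3 i v)) => //.
  by rewrite det1M ?letter_det.
by rewrite rep_e_mul ?letter_det // -vE act3_qcol.
Qed.

Lemma rep_e1 (w : 'cV_(rk Q)) : rep Q (e sl2_one) *m w = w.
Proof. by rewrite (e1 eM) (proj1 glat_Q) mul1mx. Qed.

Lemma orbit3_walk ws w k : all (ltn^~ 5) ws -> (k <= size ws)%N ->
  qcol (nth zero3 (orbit3 ws w) k) = rep Q (e (nth sl2_one (walk_elts ws) k)) *m qcol w.
Proof. by apply: orbit3_walk_from; rewrite ?rep_e1. Qed.

Lemma zcol_addz n s t : zcol n (addz s t) = zcol n s + zcol n t.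
Proof.
apply/matrixP=> i j; rewrite !mxE -rmorphD /=; congr int_of_Z.
elim: s t (i : nat) => [|x s IHs] [|y t] [|k] //=; rewrite ?nth_nil ?add0r ?addr0 //.
Qed.

Lemma zcol_scale n a s : zcol n (map (Z.mul a) s) = int_of_Z a *: zcol n s.
Proof.
apply/matrixP=> i j; rewrite !mxE -rmorphM /=; congr int_of_Z.
have [lt_i | ge_i] := ltnP i (size s); first by rewrite (nth_map Z0).
by rewrite !nth_default ?size_map // mulr0.
Qed.

Lemma qcol_add3 v w : qcol (add3 v w) = qcol v + qcol w.
Proof. by case: v w => [[x y] z] [[x' y'] z'] /=; rewrite !zcol_addz !add_col_mx. Qed.

Lemma qcol_scale3 a v : qcol (scale3 a v) = int_of_Z a *: qcol v.
Proof. by case: v => [[x y] z] /=; rewrite !zcol_scale !scale_col_mx. Qed.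

Lemma zcol0 n s : all (pred1 Z0) s -> zcol n s = 0.
Proof.
move=> /allP s0; apply/matrixP=> i j; rewrite !mxE.
have [lt_i | ge_i] := ltnP i (size s); last by rewrite nth_default.
by rewrite (eqP (s0 _ (mem_nth _ lt_i))).
Qed.

Lemma qcol_lin3 ns vs : qcol (lin3 ns vs) =
  \sum_(k < size vs) int_of_Z (nth Z0 ns k) *: qcol (nth zero3 vs k).
Proof.
have qcol0 : qcol zero3 = 0 by rewrite /= !zcol0 // !col_mx0.
elim: vs ns => [|v vs IHvs] [|a ns]; rewrite ?big_ord0 //.
  by rewrite [LHS]qcol0 big1 // => k _; rewrite nth_nil scale0r.
by rewrite big_ord_recl -IHvs [lin3 _ _]/(add3 (scale3 a v) (lin3 ns vs)) qcol_add3 qcol_scale3.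
Qed.

Definition orbit_mx rs n (w : 'cV_(rk Q)) : 'M[int]_(rk Q, n) :=
  \matrix_(i, j) (rep Q (e (nth sl2_one rs j)) *m w) i 0.

Lemma orbit_mx_lin rs n (w : 'cV_(rk Q)) ns vs : size vs = n ->
  (forall k, (k < n)%N -> qcol (nth zero3 vs k) = rep Q (e (nth sl2_one rs k)) *m w) ->
  orbit_mx rs n w *m zcol n ns = qcol (lin3 ns vs).
Proof.
move=> sz vE; rewrite qcol_lin3 sz; apply/matrixP=> i c; rewrite ord1 {c} mxE summxE.
by apply: eq_bigr => k _; rewrite vE // [RHS]mxE [orbit_mx _ _ _ _ _]mxE [zcol _ _ _ _]mxE mulrC.
Qed.

Lemma orbit_mx_equivariant hs rs n (w : 'cV_(rk Q)) :
  groupb hs -> transversalb hs rs -> size rs = n ->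
  (forall x, x \in hs -> rep Q (e x) *m w = w) ->
  equivariant G (set_lat (cosets hs rs n)) Q (orbit_mx rs n w).
Proof.
move=> hg tr sz fix_w; have rs1 : all is_sl2 rs by case/and3P: tr.
apply: (orbit_mx_eqv (H := imgG e hs)) => //.
- exact: glat_Q.
- exact: imgG_sub.
- exact: cosets_basis.
- by move=> j; rewrite eG ?det_nth.
move=> h; change (h \in (imgG e hs : {set gT}) -> rep Q h *m w = w).
by rewrite (imgGE eM hg) => /imgP[x hx ->]; apply: fix_w.
Qed.

Lemma fix_pows m n (w : 'cV_(rk Q)) x : sl2_det m = f8_1 -> rep Q (e m) *m w = w ->
  x \in pows m n -> rep Q (e x) *m w = w.
Proof.
move=> m1 mw /trajectP[i _ ->] {x n}.
suff [] : sl2_det (iter i (sl2_mul m) sl2_one) = f8_1 /\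
  rep Q (e (iter i (sl2_mul m) sl2_one)) *m w = w by [].
elim: i => [|i [d1 IHi]] /=; first by rewrite rep_e1.
by rewrite det1M // rep_e_mul // IHi.
Qed.

Notation T3 := (orbit_mx rs_C3 168 (qcol w_C3)).
Notation T9 := (orbit_mx rs_D9 28 (qcol w_D9)).
Notation T7 := (orbit_mx rs_C7 (64 + 8) (qcol w_C7)).

Lemma T3_eqv : equivariant G (set_lat b_C3) Q T3.
Proof.
apply: orbit_mx_equivariant groupb_C3 trans_C3 _ _ => // x.
have -> : hC3 = pows cC3 3 by [].
apply: fix_pows => //; rewrite (rep_e_mul (m := cC) (n := sl2_mul cC cC)) //.
rewrite (rep_e_mul (m := cC) (n := cC)) // -[cC]/(sl2_letter 0).
by rewrite !act3_qcol // fix_C3.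
Qed.

Lemma T7_eqv : equivariant G (set_lat b_C7) Q T7.
Proof.
apply: orbit_mx_equivariant groupb_C7 trans_C7 _ _ => // x.
have -> : hC7 = pows cD 7 by [].
by apply: fix_pows => //; rewrite -[cD]/(sl2_letter 2) act3_qcol // fix_C7.
Qed.

Lemma T9_eqv : equivariant G (set_lat b_D9) Q T9.
Proof.
apply: orbit_mx_equivariant groupb_D9 trans_D9 _ _ => // x.
have fixC y : y \in hC9 -> rep Q (e y) *m qcol w_D9 = qcol w_D9.
  have -> : hC9 = pows cC 9 by [].
  by apply: fix_pows => //; rewrite -[cC]/(sl2_letter 0) act3_qcol // fix_D9.
have -> : hD9 = hC9 ++ [seq sl2_mul cT m | m <- hC9] by [].
rewrite mem_cat => /orP[/fixC // | /mapP[y hy ->]].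
have y1 : sl2_det y = f8_1 by apply/eqP; case/and4P: groupb_C9 => /allP hs1 _ _ _; apply: hs1.
by rewrite rep_e_mul // fixC // -[cT]/(sl2_letter 4) act3_qcol // fix_D9'.
Qed.

(** * The projective line and the map from ordered pairs to differences *)

Definition pt m : 'cV[int]_(8 + 1) :=
  \col_i (b_B i == lcoset (imgG e hB) (e m))%:R.

Lemma ptE m : sl2_det m = f8_1 -> exists2 j, b_B j = lcoset (imgG e hB) (e m) & pt m = delta_mx j 0.
Proof.
move=> m1; have [j bj] := cosets_onto groupb_B trans_B (erefl _) (eG m1).
exists j => //; apply/matrixP=> i k; rewrite !mxE ord1 -bj andbT.
by rewrite (inj_eq (cosets_inj groupb_B trans_B (erefl _))).
Qed.

Lemma pt_mul m n : sl2_det m = f8_1 -> sl2_det n = f8_1 ->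
  rep (set_lat b_B) (e m) *m pt n = pt (sl2_mul m n).
Proof.
move=> m1 n1; have [j bj ->] := ptE n1; have [i bi ->] := ptE (det1M m1 n1).
apply: set_lat_delta; first exact: cosets_inj groupb_B trans_B (erefl _).
by rewrite bi bj eM // !lcosetE mulgA mulg_set1.
Qed.

Lemma pt_eq m n : sl2_det m = f8_1 -> sl2_det n = f8_1 ->
  sl2_mul (sl2_inv n) m \in hB -> pt m = pt n.
Proof.
move=> m1 n1; rewrite -(lcoset_img groupb_B) // => /eqP eq_mn.
by apply/matrixP=> i k; rewrite !mxE eq_mn.
Qed.

(** Infinity minus 0. The diagonal torus fixes both points, so the vector extends to an equivariant
    map on the cosets of [hC7]. *)
Definition bd_vec := pt sl2_one - pt cT.
Definition bd_mx : 'M[int]_(8 + 1, 64 + 8) :=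
  \matrix_(i, j) (rep (set_lat b_B) (e (nth sl2_one rs_C7 j)) *m bd_vec) i 0.

Lemma det_rs_C7 k : sl2_det (nth sl2_one rs_C7 k) = f8_1.
Proof. by apply: det_nth; case/and3P: trans_C7. Qed.

Lemma bd_mx_col j : bd_mx *m delta_mx j 0 =
  pt (nth sl2_one rs_C7 j) - pt (sl2_mul (nth sl2_one rs_C7 j) cT).
Proof.
have r1 := det_rs_C7 j.
have -> : bd_mx *m delta_mx j 0 = rep (set_lat b_B) (e (nth sl2_one rs_C7 j)) *m bd_vec.
  by rewrite -colE; apply/matrixP=> i k; rewrite !mxE ord1.
rewrite mulmxBr !pt_mul //; congr (_ - _); apply: pt_eq; rewrite ?det1M //.
(* It remains to compare r with [sl2_mul r sl2_one]; the unit law is used in the group, through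
   [e]. *)
rewrite -(mem_imgG eM e_inj groupb_B) ?det1M ?det1V // !eM ?det1V ?det1M //.
by rewrite (e1 eM) mulg1 (eV eM) // mulVg group1.
Qed.

Lemma bd_mxE i j :
  bd_mx i j = int_of_Z (boundary (nth sl2_one rs_C7 j) (nth sl2_one points i)).
Proof.
have -> : bd_mx i j = (bd_mx *m delta_mx j 0 : 'cV_(8 + 1)) i 0 by rewrite -colE [RHS]mxE.
have p1 : sl2_det (nth sl2_one points i) = f8_1 by apply: det_nth; case/and3P: trans_B.
have r1 := det_rs_C7 j.
have ptE' m : sl2_det m = f8_1 -> pt m i 0 = (at_pt m (nth sl2_one points i))%:R.
  by move=> m1; rewrite mxE eq_sym lcoset_img ?groupb_B.
rewrite bd_mx_col [LHS]mxE [X in _ + X]mxE !ptE' ?det1M // /boundary.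
by case: (at_pt _ _) (at_pt _ _) => [] [].
Qed.

Lemma bd_mx_eqv : equivariant G (set_lat b_C7) (set_lat b_B) bd_mx.
Proof.
apply: (orbit_mx_eqv (H := imgG e hC7)).
- exact: is_glat_set_lat basis_B.
- exact: imgG_sub groupb_C7.
- exact: basis_C7.
- by move=> j; rewrite eG ?det_rs_C7.
- by [].
move=> h; change (h \in (imgG e hC7 : {set gT}) -> rep (set_lat b_B) h *m bd_vec = bd_vec).
rewrite (imgGE eM groupb_C7) => /imgP[x hx ->].
have [x1 xB xtB] : [/\ sl2_det x = f8_1, sl2_mul (sl2_inv sl2_one) (sl2_mul x sl2_one) \in hB
    & sl2_mul (sl2_inv cT) (sl2_mul x cT) \in hB].
  have /allP/(_ x hx)/and3P[/eqP] // : all (fun x => [&& is_sl2 x,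
     sl2_mul (sl2_inv sl2_one) (sl2_mul x sl2_one) \in hB &
     sl2_mul (sl2_inv cT) (sl2_mul x cT) \in hB]) hC7 by vm_compute.
by rewrite mulmxBr !pt_mul //; congr (_ - _); apply: pt_eq; rewrite ?det1M.
Qed.

Lemma one_bd_mx : const_mx 1 *m bd_mx = 0 :> 'rV_(64 + 8).
Proof.
apply: eq_mx_delta => j; rewrite mul0mx -mulmxA bd_mx_col mulmxBr.
have r1 := det_rs_C7 j.
have [k _ ->] := ptE r1; have [l _ ->] := ptE (det1M r1 (erefl (sl2_det cT))).
by rewrite !const_mx_delta subrr.
Qed.

Lemma bd_mx_split : rsubmx (aug_out 8 *m bd_mx) = 1%:M.
Proof.
have -> : aug_out 8 *m bd_mx = usubmx bd_mx.
  by rewrite -[bd_mx in LHS]vsubmxK mul_row_col mul1mx mul0mx addr0.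
apply/matrixP=> i j; rewrite [LHS]mxE [LHS]mxE bd_mxE [RHS]mxE.
have i8 : (i : nat) \in iota 0 8 by rewrite mem_iota /=.
have j8 : (j : nat) \in iota 0 8 by rewrite mem_iota /=.
have /eqP := allP (allP split_check _ i8) _ j8.
by rewrite /= => ->; rewrite -val_eqE /=; case: eqP.
Qed.

Lemma cosets_transl hs rs n (j : 'I_n.+1) : groupb hs -> transversalb hs rs ->
  size rs = n.+1 -> nth sl2_one rs 0 = sl2_one ->
  rep (set_lat (cosets hs rs n.+1)) (e (nth sl2_one rs j)) *m delta_mx 0 0 =
  delta_mx j 0 :> 'cV_n.+1.
Proof.
move=> hg tr sz r0; apply: set_lat_delta; first exact: cosets_inj tr sz.
by rewrite /cosets r0 (e1 eM) [lcoset _ 1]lcosetE mul1g.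
Qed.

Lemma zcol_unit n : zcol n.+1 (unitz n) = delta_mx 0 0.
Proof.
apply/matrixP=> i j; rewrite !mxE (ord1 j) andbT.
by case: i => [[|i] ?] //=; rewrite nth_nseq; case: ifP.
Qed.

Lemma zcol_zero n m : zcol n (zeroz m) = 0.
Proof. by apply: zcol0; rewrite all_nseq orbT. Qed.

Lemma T7_orbit k : (k < 72)%N ->
  qcol (nth zero3 (reorder (orbit3 walk_C7 w_C7)) k) =
  rep Q (e (nth sl2_one rs_C7 k)) *m qcol w_C7.
Proof.
move=> lt_k; have -> : rs_C7 = [seq nth sl2_one (walk_elts walk_C7) i | i <- order_C7].
  by vm_compute.
have sz : size order_C7 = 72%N by [].
rewrite /reorder !(nth_map 0%N) ?sz // orbit3_walk //.
have /allP le_o : all (fun i => i <= size walk_C7)%N order_C7 by [].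
by apply: le_o; rewrite mem_nth ?sz.
Qed.

(** It is enough to kill the transpose of [bd_mx], defined on all nine points. By self-duality of
    permutation lattices this composite is equivariant, so transitivity reduces it to the column at
    infinity. *)
Lemma T7_kill : T7 *m res_in bd_mx = 0.
Proof.
suff T7D : T7 *m bd_mx^T = 0 by rewrite /res_in trmx_mul mulmxA T7D mul0mx.
pose i0 : 'I_(8 + 1) := ord0.
have T7D0 : T7 *m bd_mx^T *m delta_mx i0 0 = 0 :> 'cV_(rk Q).
  have -> : T7 *m bd_mx^T *m delta_mx i0 0 =
      T7 *m zcol (64 + 8) [seq boundary m sl2_one | m <- rs_C7].
    rewrite -mulmxA; congr (_ *m _); rewrite -colE; apply/matrixP=> j k.
    by rewrite [LHS]mxE [LHS]mxE bd_mxE [RHS]mxE (nth_map sl2_one).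
  rewrite (orbit_mx_lin _ (vs := reorder (orbit3 walk_C7 w_C7))) //; last exact: T7_orbit.
  by rewrite kill_check qcolE !zcol_zero !col_mx0.
apply: eq_mx_delta => i; rewrite mul0mx.
rewrite -(cosets_transl i groupb_B trans_B (erefl _) (erefl _)).
set g := e _; have Gg : g \in G by apply/eG/det_nth; case/and3P: trans_B.
have eqvDt : bd_mx^T *m rep (set_lat b_B) g = rep (set_lat b_C7) g *m bd_mx^T.
  apply: trmx_inj; rewrite !trmx_mul !trmxK -[g]invgK.
  rewrite -[in LHS](set_lat_tr b_B) -[in RHS](set_lat_tr b_C7) !trmxK.
  by rewrite bd_mx_eqv ?groupV.
rewrite mulmxA -[_ *m bd_mx^T *m _]mulmxA eqvDt mulmxA -T7_eqv //.
by rewrite -!mulmxA [T7 *m _]mulmxA T7D0 mulmx0.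
Qed.

(** * The isomorphism of rank 260 *)

Notation Fl := (quo_lat b_C7 bd_mx).
Notation Q1 := (dsum (set_lat b_C3) (set_lat b_D9)).
Definition T : 'M[int]_(rk Q, rk (dsum Q1 Fl)) := row_mx (row_mx T3 T9) (lsubmx T7).

Lemma T_eqv : equivariant G (dsum Q1 Fl) Q T.
Proof.
apply: row_mx_eqv; first by apply: row_mx_eqv; [exact: T3_eqv | exact: T9_eqv].
apply: quo_map_eqv T7_kill; [exact: bd_mx_split | exact: T7_eqv].
Qed.

Lemma T_pre u v :
  combine (orbit3 walk_C3 w_C3) (orbit3 walk_D9 w_D9) (reorder (orbit3 walk_C7 w_C7)) u = v ->
  exists u' : 'cV_(rk (dsum Q1 Fl)), T *m u' = qcol v.
Proof.
move=> <-; case: u => [[x y] z]; rewrite /combine.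
(* [T7] factors through [res_out], so coefficients [z] over all 72 pairs are accepted and then
   pushed to the quotient. *)
exists (col_mx (col_mx (zcol 168 x) (zcol 28 y)) (res_out bd_mx *m zcol (64 + 8) z)).
rewrite !mul_row_col mulmxA (quo_mapK bd_mx_split T7_kill) !qcol_add3.
rewrite -(@orbit_mx_lin rs_C3 168 (qcol w_C3)) //; last first.
  by move=> k lt_k; rewrite orbit3_walk.
rewrite -(@orbit_mx_lin rs_D9 28 (qcol w_D9)) //; last first.
  by move=> k lt_k; rewrite orbit3_walk.
by rewrite -(@orbit_mx_lin rs_C7 (64 + 8) (qcol w_C7)) //; exact: T7_orbit.
Qed.

Lemma T_pre_transl (v : 'cV_(rk Q)) g : g \in G ->
  (exists u, T *m u = v) -> exists u, T *m u = rep Q g *m v.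
Proof.
by move=> Gg [u <-]; exists (rep (dsum Q1 Fl) g *m u); rewrite !mulmxA T_eqv.
Qed.

Lemma T_onto (j : 'I_(168 + 56 + 36)) :
  exists u : 'cV_(rk (dsum Q1 Fl)), T *m u = delta_mx j 0.
Proof.
have map3 (A B : Type) (f : A -> B) a b c x y z :
    [seq f i | i <- [:: a; b; c]] = [:: x; y; z] -> [/\ f a = x, f b = y & f c = z].
  by case.
have [/T_pre b1 /T_pre b2 /T_pre b3] := map3 _ _ _ _ _ _ _ _ _ combineE.
move: b1 b2 b3; rewrite !qcolE !zcol_unit !zcol_zero => b1 b2 b3.
have [r3 r9 r7] : [/\ all is_sl2 rs_C3, all is_sl2 rs_C9 & all is_sl2 rs_D7].
  by split; [case/and3P: trans_C3 | case/and3P: trans_C9 | case/and3P: trans_D7].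
case: (split_ordP j) => [{}j -> | k ->].
  case: (split_ordP j) => k ->; rewrite !delta_mx_ushift ?delta_mx_dshift.
    have := T_pre_transl (eG (det_nth k r3)) b1.
    rewrite !mul_block_col !(mul0mx, mulmx0, addr0).
    by rewrite (cosets_transl k groupb_C3 trans_C3 (erefl _) (erefl _)).
  have := T_pre_transl (eG (det_nth k r9)) b2.
  rewrite !mul_block_col !(mul0mx, mulmx0, addr0, add0r).
  by rewrite (cosets_transl k groupb_C9 trans_C9 (erefl _) (erefl _)).
rewrite delta_mx_dshift; have := T_pre_transl (eG (det_nth k r7)) b3.
rewrite !mul_block_col !(mul0mx, mulmx0, addr0, add0r).
by rewrite (cosets_transl k groupb_D7 trans_D7 (erefl _) (erefl _)) col_mx0.
Qed.

Lemma T_iso : lat_iso G (dsum Q1 Fl) Q.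
Proof. exact: lat_iso_surj T_eqv T_onto. Qed.

Lemma permutation_foldr (Hs : seq {group gT}) : all (fun H : {group gT} => H \subset G) Hs ->
  permutation_lat G (foldr (@dsum gT) (@zero_lat gT) [seq perm_lat G H | H : {group gT} <- Hs]).
Proof.
move=> sHs; split; last by exists Hs; split=> //; apply: lat_iso_refl.
elim: Hs sHs => [|H Hs IHs] /=; first by move=> _; apply: is_glat_zero.
by case/andP=> sHG /IHs; apply: is_glat_dsum; apply: is_glat_perm_lat.
Qed.

Lemma permutation_C7 : permutation_lat G (set_lat b_C7).
Proof.
split; first exact: is_glat_set_lat basis_C7.
(* Conjugation by 1 brings the subgroup to the form that [cosets_iso] produces. *)
exists [:: (imgG e hC7 :^ 1)%G]; split; first by rewrite /= conjsg1 andbT imgG_sub ?groupb_C7.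
apply: (@lat_iso_trans _ _ _ (perm_lat G (imgG e hC7 :^ 1)%G)).
  by apply/sum_iso_lat_iso/cosets_iso; rewrite ?groupb_C7 ?trans_C7.
exact: lat_iso_sym (lat_iso_dsum0 _ _).
Qed.

(** * Transport to the subgroups of the statement *)

Section Conjugates.
Variables (S C3 C9 D7 D9 : {group gT}).
Hypotheses (sylS : S \in 'Syl_2(G)%g) (sC3 : C3 \subset G) (oC3 : #|C3| = 3%N)
  (sC9 : C9 \subset G) (cycC9 : cyclic C9) (oC9 : #|C9| = 9%N)
  (sD7 : D7 \subset G) (oD7 : #|D7| = 14%N) (sD9 : D9 \subset G) (oD9 : #|D9| = 18%N).

Lemma perm_lat_conj hs rs n (K : {group gT}) :
  groupb hs -> transversalb hs rs -> size rs = n ->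
  (exists2 x, x \in G & K :=: (imgG e hs :^ x)%G) ->
  sum_iso G (set_lat (cosets hs rs n)) (perm_lat G K).
Proof.
move=> hg tr sz [x Gx KE]; have -> : K = (imgG e hs :^ x)%G by apply: group_inj.
exact: cosets_iso.
Qed.

Lemma iso_C3 : lat_iso G (set_lat b_C3) (perm_lat G C3).
Proof.
apply/sum_iso_lat_iso/perm_lat_conj; rewrite ?groupb_C3 ?trans_C3 //.
exact: C3_conj cycC9 oC9 sC3 oC3.
Qed.

Lemma iso_C9 : lat_iso G (set_lat b_C9) (perm_lat G C9).
Proof.
apply/sum_iso_lat_iso/perm_lat_conj; rewrite ?groupb_C9 ?trans_C9 //.
exact: C9_conj sC9 oC9.
Qed.

Lemma iso_D7 : lat_iso G (set_lat b_D7) (perm_lat G D7).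
Proof.
apply/sum_iso_lat_iso/perm_lat_conj; rewrite ?groupb_D7 ?trans_D7 //.
exact: D7_conj sD7 oD7.
Qed.

Lemma iso_D9 : lat_iso G (set_lat b_D9) (perm_lat G D9).
Proof.
apply/sum_iso_lat_iso/perm_lat_conj; rewrite ?groupb_D9 ?trans_D9 //.
exact: D9_conj sD9 oD9.
Qed.

(** Kept as a [sum_iso], since the Chevalley lattice is defined from the augmentation kernel of this
    very permutation lattice. *)
Lemma iso_B : sum_iso G (set_lat b_B) (perm_lat G 'N_G(S)%G).
Proof.
apply: perm_lat_conj; rewrite ?groupb_B ?trans_B //.
exact: Borel_conj sylS.
Qed.

Lemma rank260_iso :
  lat_iso G (dsum (dsum (perm_lat G C3) (perm_lat G C9)) (perm_lat G D7))
            (dsum (dsum (perm_lat G C3) (perm_lat G D9)) Fl).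
Proof.
apply: lat_iso_trans (lat_iso_sym (lat_iso_dsum (lat_iso_dsum iso_C3 iso_C9) iso_D7)) _.
apply: lat_iso_trans (lat_iso_sym T_iso) _.
exact: lat_iso_dsum (lat_iso_dsum iso_C3 iso_D9) (lat_iso_refl _ _).
Qed.

Lemma glat_Fl : is_glat G Fl.
Proof. exact (is_glat_quo_lat basis_C7 bd_mx_eqv one_bd_mx bd_mx_split). Qed.

Lemma flabby_Fl : flabby G Fl.
Proof.
split=> [|K sKG]; first exact: glat_Fl.
apply: (@tateHm1_dsum_r _ _ K Q1) => //; apply: tateHm1_iso T_iso _ => //.
do 2?apply: tateHm1_dsum => //; apply: tateHm1_set_lat sKG;
  [exact: basis_C3 | exact: basis_C9 | exact: basis_D7].
Qed.

Lemma stably_permutation_Fl : stably_permutation G Fl.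
Proof.
split; first exact: glat_Fl.
exists (foldr (@dsum gT) (@zero_lat gT) [seq perm_lat G H | H : {group gT} <- [:: C3; D9]]).
exists (foldr (@dsum gT) (@zero_lat gT) [seq perm_lat G H | H : {group gT} <- [:: C3; C9; D7]]).
split; try by apply: permutation_foldr; rewrite /= ?sC3 ?sC9 ?sD7 ?sD9.
have sum2 L M : lat_iso G (dsum L (dsum M zero_lat)) (dsum L M).
  exact: lat_iso_dsum (lat_iso_refl _ _) (lat_iso_dsum0 _ _).
apply: lat_iso_trans (lat_iso_dsumC _ _ _) _.
apply: lat_iso_trans (lat_iso_dsum (sum2 _ _) (lat_iso_refl _ _)) _.
apply: lat_iso_trans (lat_iso_sym rank260_iso) _.
apply: lat_iso_trans (lat_iso_dsumA _ _ _ _) _.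
exact: lat_iso_dsum (lat_iso_refl _ _) (lat_iso_sym (sum2 _ _)).
Qed.

Lemma model_theorem :
  exists (J P L : glat gT) (A : 'M[int]_(rk P, rk J)) (B : 'M[int]_(rk L, rk P)),
    [/\ is_chevalley_lat G 'N_G(S)%G J, flabby_resolution G J P L A B, rk L = 64%N,
        lat_iso G (dsum (dsum (perm_lat G C3) (perm_lat G C9)) (perm_lat G D7))
                  (dsum (dsum (perm_lat G C3) (perm_lat G D9)) L)
      & stably_permutation G L].
Proof.
exists (dual_lat (aug_lat b_B)), (set_lat b_C7), Fl, (res_in bd_mx), (res_out bd_mx).
split=> //.
- exists (aug_lat b_B); split=> //.
  exact (is_augmentation_aug_lat basis_B iso_B).
- exact (quo_lat_resolution basis_B bd_mx_eqv one_bd_mx bd_mx_split permutation_C7 flabby_Fl).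
- exact: rank260_iso.
exact: stably_permutation_Fl.
Qed.
End Conjugates.
End Coordinates.

Theorem theorem1p3 (F : finFieldType) (S C3 C9 D7 D9 : {group coset_of (scalarsGL F)}) :
  #|F| = 8%N ->
  (S \in 'Syl_2(PSL2 F))%g ->
  C3 \subset PSL2 F -> cyclic C3 -> #|C3| = 3%N ->
  C9 \subset PSL2 F -> cyclic C9 -> #|C9| = 9%N ->
  D7 \subset PSL2 F -> (D7 \isog [set: 'D_14])%g ->
  D9 \subset PSL2 F -> (D9 \isog [set: 'D_18])%g ->
  let G := PSL2 F in
  let H := ('N_G(S))%G in
  exists (J P Fl : glat (coset_of (scalarsGL F)))
         (A : 'M[int]_(rk P, rk J)) (B : 'M[int]_(rk Fl, rk P)),
    [/\ is_chevalley_lat G H J,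
        flabby_resolution G J P Fl A B,
        rk Fl = 64%N,
        lat_iso G (dsum (dsum (perm_lat G C3) (perm_lat G C9)) (perm_lat G D7))
                  (dsum (dsum (perm_lat G C3) (perm_lat G D9)) Fl)
      & stably_permutation G Fl].
Proof.
move=> cardF sylS sC3 _ oC3 sC9 cycC9 oC9 sD7 isoD7 sD9 isoD9 G H.
(* The choice of a root fixes the identification of [f8] with [F], and with it all the explicit
   subgroups. *)
have [a a3] := cubic_root_exists cardF.
apply: (model_theorem (embM cardF a3) (emb_inj cardF a3) (emb_mem cardF a3)
          (emb_onto cardF a3) (det_mul cardF a3)) => //.
- exact (etrans (card_isog isoD7) (@card_dihedral 7 isT)).
exact (etrans (card_isog isoD9) (@card_dihedral 9 isT)).
Qed.
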